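(* Let $r,t>0$. Then the Yor integral $F_t(r)$ satisfies the equation $$F_t(r)=\sum_{k=1}^\infty\frac{(-1)^k\pi^{2(k-1)}}{(2k-1)!}\,\left(g_k*F_t\right)(r),\qquad g_k(u)=e^{-u}\,\frac{p_k(u)}{u}.$$ Moreover, it can be rewritten in the form $$F_t(r)=\sum_{k=1}^\infty\frac{(-1)^k\pi^{2(k-1)}a_k(r,t)}{(2k-1)!},\qquad a_k(r,t)=\int_0^\infty e^{-u}\,h_t(r,u)\,p_k(u)\,\frac{du}{u}.$$
   Context: The Yor integral is defined for $r,t>0$ by $$F_t(r)=\frac{e^{\pi^2/2t}}{\sqrt{2\pi^3t}}\int_0^\infty\exp\left(-\frac{y^2}{2t}\right)\exp(-r\cosh y)\,\sinh y\,\sin\left(\frac{\pi y}{t}\right)dy.$$ The polynomials $p_n$ are defined by $p_n(x)=(-1)^ne^{x}\mathcal{A}_x^ne^{-x}$, $n\in\mathbb{N}_0$, where $\mathcal{A}_x^n$ is the $n$-th iterate of the differential operator $(\mathcal{A}_xf)(x)=x^2f(x)-x\,(xf'(x))'$; $p_n$ is a polynomial of degree $n$. The operation $*$ is the convolution for the Kontorovich-Lebedev transform, $$(f*h)(x)=\frac1{2x}\int_0^\infty\int_0^\infty e^{-\frac12\left(x\frac{u^2+y^2}{uy}+\frac{yu}{x}\right)}f(u)h(y)\,du\,dy,\qquad x>0.$$ $K_\nu$ is the modified Bessel function (Macdonald function), $K_\nu(x)=\int_0^\infty e^{-x\cosh u}\cosh(\nu u)\,du$ for $x>0$. The heat kernel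 for the Kontorovich-Lebedev transform is, for $t,x,y>0$, $$h_t(x,y)=\frac{2}{x\pi^2}\int_0^\infty e^{-t\tau^2/2}\,\tau\sinh(\pi\tau)\,K_{i\tau}(x)K_{i\tau}(y)\,d\tau.$$
   Formalization: The second series is stated with an extra factor 1/2: with the given h_t (factor 2/(xπ²)) one has a_k(r,t) = 2(g_k*F_t)(r), so the series as printed sums to 2F_t(r), which differs from F_t(r) > 0. *)

(* Defs.v *)
From HB Require Import structures.
From mathcomp Require Export all_boot all_order all_algebra.
From mathcomp Require Export all_classical all_reals all_analysis.
From mathcomp Require Export complex.

Set Implicit Arguments.
Unset Strict Implicit.
Unset Printing Implicit Defensive.

Import Order.TTheory GRing.Theory Num.Theory.
Import numFieldNormedType.Exports.

Local Open Scope classical_set_scope.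
Local Open Scope ring_scope.

Section Functions.
Context {R : realType}.

Definition int0oo (f : R -> R) : R :=
  \int[@lebesgue_measure R]_(x in `]0, +oo[) f x.

Definition cosh (x : R) : R := (expR x + expR (- x)) / 2.
Definition sinh (x : R) : R := (expR x - expR (- x)) / 2.

Definition yor (t r : R) : R :=
  expR (pi ^+ 2 / (2 * t)) / Num.sqrt (2 * pi ^+ 3 * t) *
  int0oo (fun y => expR (- (y ^+ 2 / (2 * t))) * expR (- (r * cosh y)) *
                   sinh y * sin (pi * y / t)).

Definition opA (f : R -> R) : R -> R :=
  fun x => x ^+ 2 * f x - x * derive1 (fun y => y * derive1 f y) x.

Definition yor_poly (n : nat) (x : R) : R :=
  (-1) ^+ n * expR x * iter n opA (fun y => expR (- y)) x.

Definition KLconv (f h : R -> R) (x : R) : R :=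
  1 / (2 * x) *
  int0oo (fun y => int0oo (fun u =>
    expR (- (1 / 2 * (x * ((u ^+ 2 + y ^+ 2) / (u * y)) + y * u / x))) *
    f u * h y)).

Definition cexp (z : R[i]) : R[i] :=
  Complex (expR (complex.Re z) * cos (complex.Im z))
          (expR (complex.Re z) * sin (complex.Im z)).

Definition ccosh (z : R[i]) : R[i] := (cexp z + cexp (- z)) / 2.

Definition cint0oo (f : R -> R[i]) : R[i] :=
  Complex (int0oo (fun u => complex.Re (f u)))
          (int0oo (fun u => complex.Im (f u))).

Definition macdonald (nu : R[i]) (x : R) : R[i] :=
  cint0oo (fun u => (expR (- (x * cosh u)))%:C%C * ccosh (nu * u%:C%C)).

(* [K_{i tau}(x)] is real, so taking the real part loses nothing. *)
Definition macdonald_im (tau x : R) : R :=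
  complex.Re (macdonald (Complex 0 tau) x).

(* Normalisation: by the sine-Fourier transform of the Gaussian,
     yor t y = 1/(y pi^2) *
       int_0^oo e^(-t tau^2/2) tau sinh(pi tau) K_{i tau}(y) dtau,
   whereas [heat_kernel] carries the factor 2/(x pi^2).  Since the convolution
   turns K_{i tau}(y)/y into K_{i tau}(x) K_{i tau}(u)/x, one has
     int_0^oo heat_kernel t x u * f u du = 2 * KLconv f (yor t) x. *)
Definition heat_kernel (t x y : R) : R :=
  2 / (x * pi ^+ 2) *
  int0oo (fun tau => expR (- (t * tau ^+ 2 / 2)) * tau * sinh (pi * tau) *
                     macdonald_im tau x * macdonald_im tau y).

Definition yor_g (k : nat) (u : R) : R := expR (- u) * (yor_poly k u / u).

Definition yor_a (k : nat) (r t : R) : R :=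
  int0oo (fun u => expR (- u) * heat_kernel t r u * yor_poly k u / u).

End Functions.

(* Main.v *)
Require Import Defs.
From mathcomp Require Import ring lra zify.
From mathcomp Require Import measurable_realfun lebesgue_integral_under.

(** Write K_{i tau} for the Macdonald function of imaginary order and
    E(tau) = e^{-t tau^2/2}.  Everything happens on the spectral side of the
    Kontorovich-Lebedev transform, where the series becomes the Taylor series
    of sinh.

    The Yor integral has the spectral form ([yor_spectral])
      F_t(r) = 1/(r pi^2) int_0^oo E(tau) tau sinh(pi tau) K_{i tau}(r) dtau.
    The operator A acts on K_{i tau} as multiplication by tau^2, so passing
    from p_k to p_{k+1} multiplies the moment int e^{-u} p_k(u) K_{i tau}(u) du/u
    by -tau^2, and ([klmoment_klpoly], [sechsq_moment_sinh])
      int_0^oo e^{-u} p_k(u) K_{i tau}(u) du/u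
        = (-1)^k pi tau^{2k-1} / sinh(pi tau).
    Inserting the definition of the heat kernel into a_k and exchanging the
    integrals, the factor sinh(pi tau) cancels ([yor_aE]):
      a_k(r,t) = (-1)^k 2/(r pi) int_0^oo E(tau) tau^{2k} K_{i tau}(r) dtau.
    Hence half of the n-th partial sum of the second series is the spectral
    form of F_t(r) with sinh(pi tau) replaced by its n-th Taylor polynomial,
    and dominated convergence gives the limit, since for positive arguments the
    Taylor polynomials are bounded by sinh ([cvg_partial_yor]).

    For the first series, Macdonald's product formula ([macdonald_product])
    writes K_{i tau}(r) K_{i tau}(u) as an integral of K_{i tau}(y)/y against
    the convolution kernel, so that h_t(r,u) is 1/r times the integral of F_t
    against that kernel ([heat_kernel_conv]), and g_k * F_t = a_k/2
    ([KLconvE]): the two series agree term by term.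

    After integrating in u, the only integral to be evaluated is
      int_0^oo cos(tau v)/(1 + cosh v) dv = pi tau / sinh(pi tau).
    It is obtained without contour integration, by comparing it with
    int_0^{pi/2} cosh(2 tau v) dv = sinh(pi tau)/(2 tau): raising the weights
    1/(1 + cosh v) and cos v to higher powers gives two sequences of integrals,
    and two integrations by parts show that their product satisfies a recursion
    free of tau.  Both weights concentrate at v = 0, where the two integrands
    no longer see tau. *)

Set Implicit Arguments.
Unset Strict Implicit.
Unset Printing Implicit Defensive.

Import Order.TTheory GRing.Theory Num.Theory.
Import numFieldNormedType.Exports.
Local Open Scope classical_set_scope.
Local Open Scope ring_scope.

(** * Integration on the half-line and on the line *)

Section Toolkit.
Context {R : realType}.
Notation mu := (@lebesgue_measure R).
Implicit Types (D E : set R).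

Lemma measurable_inv : measurable_fun setT (fun x : R => x^-1).
Proof.
rewrite (_ : (fun x : R => x^-1) = (fun x : R => x * (x ^+ 2) `^ (-1))).
  apply: measurable_funM => //.
  apply: (measurableT_comp (measurable_powR (-1))) => //.
apply/funext => x; have [->|x0] := eqVneq x 0; first by rewrite invr0 mul0r.
by rewrite powR_inv1 ?sqr_ge0// expr2 invfM mulrA divff// mul1r.
Qed.

Lemma measurable_fun_inv d (T : measurableType d) (f : T -> R) :
  measurable_fun setT f -> measurable_fun setT (fun x => (f x)^-1).
Proof. exact: measurableT_comp measurable_inv. Qed.

Lemma measurable_Rintegral d (T : measurableType d) E (f : T -> R -> R) :
  measurable E -> measurable_fun setT (fun z : T * R => f z.1 z.2) ->
  measurable_fun setT (fun x => \int[mu]_(y in E) f x y).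
Proof.
move=> mE mf.
pose g (z : T * R) := (f z.1 z.2 * \1_E z.2)%:E.
have mg : measurable_fun setT g.
  apply/measurable_EFinP/measurable_funM => //.
  exact: (measurableT_comp (measurable_indic mE)).
rewrite (_ : (fun x => _) = fun x => fine
  (\int[mu]_y g^\+ (x, y) - \int[mu]_y g^\- (x, y))%E).
  apply: (measurableT_comp (@fine_measurable R setT measurableT)).
  apply: emeasurable_funB.
  - by apply: (@measurable_fun_fubini_tonelli_F _ _ _ _ _ mu (g^\+)%E) => //;
      exact: measurable_funepos.
  - by apply: (@measurable_fun_fubini_tonelli_F _ _ _ _ _ mu (g^\-)%E) => //;
      exact: measurable_funeneg.
apply/funext => x; rewrite /Rintegral integral_mkcond.
have -> : (EFin \o f x) \_ E = (fun y => g (x, y)).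
  by apply/funext => y; rewrite epatch_indic.
by rewrite integralE; congr (fine (_ - _)%E); apply: eq_integral => y _;
  rewrite ?funeposE ?funenegE.
Qed.

(** The integral of |f| over one variable need only be dominated by an integrable
    function h of the other one, for every value of that variable; the slices in the
    first variable are then integrable almost everywhere only, and the real
    integral hides the exceptional null set. *)
Lemma Rintegral_swap D E (f : R -> R -> R) (h : R -> R) :
  measurable D -> measurable E ->
  measurable_fun setT (fun z : R * R => f z.1 z.2) ->
  (forall y, E y -> mu.-integrable D (EFin \o f ^~ y) /\
    \int[mu]_(x in D) `|f x y| <= h y) ->
  mu.-integrable E (EFin \o h) ->
  [/\ mu.-integrable D (EFin \o (fun x => \int[mu]_(y in E) f x y)),
     mu.-integrable E (EFin \o (fun y => \int[mu]_(x in D) f x y)) &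
     \int[mu]_(x in D) (\int[mu]_(y in E) f x y) =
     \int[mu]_(y in E) (\int[mu]_(x in D) f x y)].
Proof.
move=> mD mE mf fh ih.
have mfT : measurable_fun setT (fun z : R * R => f z.2 z.1).
  exact: (measurableT_comp mf (measurable_fun_pair measurable_snd measurable_fst)).
pose g (z : R * R) := (f z.1 z.2 * \1_E z.2 * \1_D z.1)%:E.
have mg : measurable_fun setT g.
  apply/measurable_EFinP/measurable_funM; first apply: measurable_funM => //.
    exact: (measurableT_comp (measurable_indic mE)).
  exact: (measurableT_comp (measurable_indic mD)).
have ig : (mu \x mu)%E.-integrable setT g.
  apply/(integrable21ltyP mu mu mg).
  apply: (@le_lt_trans _ _ (\int[mu]_(y in E) (h y)%:E)%E); last first.
    by rewrite ltey_eq (integrable_fin_num _ ih).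
  rewrite [leRHS]integral_mkcond.
  apply: (@ge0_le_integral _ _ R mu setT) => //.
  - by move=> y _; apply: integral_ge0.
  - apply: (@measurable_fun_fubini_tonelli_G _ _ _ _ _ mu (fun z => `|g z|)%E) => //.
    exact: measurableT_comp.
  - by apply/(measurable_restrictT _ mE); exact: measurable_int ih.
  - move=> y _; rewrite patchE /g /=; case: ifPn => [Ey|nEy]; last first.
      under eq_integral do rewrite indicE (negbTE nEy) mulr0 mul0r normr0.
      by rewrite integral0.
    have {}Ey := set_mem Ey; have [fi fle] := fh y Ey.
    under eq_integral do rewrite indicE (mem_set Ey) mulr1.
    under eq_integral do rewrite -abse_EFin.
    rewrite (_ : (\int[mu]_x _)%E = \int[mu]_(x in D) `|(f x y)%:E|%E)%E.
      have /integrable_abse/integrable_fin_num/fineK <- // := fi.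
    rewrite [RHS]integral_mkcond; apply: eq_integral => x _.
    rewrite epatch_indic /= normrM EFinM; congr (_ * _)%E.
    by rewrite ger0_norm.
have idE x : D x -> (\int[mu]_(y in E) (f x y)%:E = \int[mu]_y g (x, y))%E.
  move=> Dx; rewrite integral_mkcond; apply: eq_integral => y _.
  by rewrite epatch_indic /g /= indicE [in RHS]indicE (mem_set Dx) mulr1 -EFinM.
have idD y : E y -> (\int[mu]_(x in D) (f x y)%:E = \int[mu]_x g (x, y))%E.
  move=> Ey; rewrite integral_mkcond; apply: eq_integral => x _.
  by rewrite epatch_indic /g /= [\1_E y]indicE (mem_set Ey) mulr1 -EFinM.
have iF := integrable_fubini_F ig.
have mgT : measurable_fun setT (fun z : R * R => g (z.2, z.1)).
  exact: (measurableT_comp mg (measurable_fun_pair measurable_snd measurable_fst)).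
have igT : (mu \x mu)%E.-integrable setT (fun z : R * R => g (z.2, z.1)).
  by apply/(integrable12ltyP mu mu mgT); apply/(integrable21ltyP mu mu mg).
have iG := integrable_fubini_F igT.
have absf (z : \bar R) : (`|(fine z)%:E| <= `|z|)%E.
  by case: z => [z| |]/=; rewrite ?normr0 ?lexx ?leey.
have ID : mu.-integrable D (EFin \o (fun x => \int[mu]_(y in E) f x y)).
  apply: (@le_integrable _ _ _ mu D mD _ (fubini_F mu g)).
  - apply/measurable_EFinP; apply: measurable_funTS.
    exact: (@measurable_Rintegral _ _ E f).
  - by move=> x Dx; rewrite /fubini_F -idE//; exact: absf.
  - exact: integrableS iF.
have IE : mu.-integrable E (EFin \o (fun y => \int[mu]_(x in D) f x y)).
  apply: (@le_integrable _ _ _ mu E mE _ (fubini_F mu (fun z : R * R => g (z.2, z.1)))).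
  - apply/measurable_EFinP; apply: measurable_funTS.
    exact: (@measurable_Rintegral _ _ D (fun y x => f x y)).
  - by move=> y Ey; rewrite /fubini_F /= -idD//; exact: absf.
  - exact: integrableS iG.
split => //; rewrite [LHS]/Rintegral [RHS]/Rintegral; congr fine.
transitivity (\int[mu]_x \int[mu]_y g (x, y))%E; last first.
  rewrite Fubini// [RHS]integral_mkcond; apply: eq_integral => y _.
  rewrite patchE; case: ifPn => [/set_mem Ey|nEy].
    rewrite -idD// /Rintegral fineK// integrable_fin_num//.
    exact: (fh y Ey).1.
  rewrite /g /=; under eq_integral do rewrite indicE (negbTE nEy) mulr0 mul0r.
  by rewrite integral0.
rewrite [LHS]integral_mkcond; apply: ae_eq_integral => //.
- apply/(measurable_restrictT _ mD); exact: measurable_int ID.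
- exact: measurable_int iF.
have := ae_integrable1 ig; apply: filterS => x ix _.
rewrite patchE; case: ifPn => [/set_mem Dx|nDx].
  by rewrite /Rintegral fineK idE// integrable_fin_num.
rewrite /g /=; under [RHS]eq_integral do rewrite [X in _ * X]indicE (negbTE nDx) mulr0.
by rewrite integral0.
Qed.

Notation Rpos := (`]0%R, +oo[%classic : set R).
Notation itg f := (mu.-integrable Rpos (EFin \o f)).

Lemma measurable_Rpos : measurable Rpos. Proof. exact: measurable_itv. Qed.

Lemma RposE (x : R) : Rpos x = (0 < x) :> Prop.
Proof. by rewrite /= in_itv/= andbT. Qed.

Lemma int0oo_eq (f g : R -> R) :
  (forall x, 0 < x -> f x = g x) -> int0oo f = int0oo g.
Proof.
by move=> fg; apply: eq_Rintegral => x /set_mem; rewrite RposE => /fg.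
Qed.

Lemma itg_eq (f g : R -> R) :
  (forall x, 0 < x -> f x = g x) -> itg f -> itg g.
Proof.
move=> fg; apply: eq_integrable => [|x /set_mem]; first exact: measurable_Rpos.
by rewrite RposE => x0 /=; rewrite fg.
Qed.

Lemma itg_le (f g : R -> R) : measurable_fun setT f ->
  (forall x, 0 < x -> `|f x| <= g x) -> itg g -> itg f.
Proof.
move=> mf fg; apply: le_integrable; first exact: measurable_Rpos.
  by apply/measurable_EFinP; exact: measurable_funTS.
move=> x; rewrite RposE => x0 /=; rewrite lee_fin.
by rewrite (le_trans (fg x x0))// ler_norm.
Qed.

Lemma itgZ (c : R) (f : R -> R) : itg f -> itg (fun x => c * f x).
Proof.
by move=> i; apply: (@integrableZl _ _ R mu Rpos _ c (EFin \o f)).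
Qed.

Lemma itgD (f g : R -> R) : itg f -> itg g -> itg (fun x => f x + g x).
Proof.
move=> i1 i2.
by apply: (@integrableD _ _ R mu Rpos _ (EFin \o f) (EFin \o g)).
Qed.

Lemma itg_norm (f : R -> R) : itg f -> itg (fun x => `|f x|).
Proof. by move=> /integrable_norm. Qed.

Lemma int0ooZ (c : R) (f : R -> R) : itg f ->
  int0oo (fun x => c * f x) = c * int0oo f.
Proof. by move=> i; rewrite /int0oo RintegralZl//; exact: measurable_Rpos. Qed.

Lemma int0ooD (f g : R -> R) : itg f -> itg g ->
  int0oo (fun x => f x + g x) = int0oo f + int0oo g.
Proof. by move=> i1 i2; rewrite /int0oo RintegralD//; exact: measurable_Rpos. Qed.

Lemma le_int0oo (f g : R -> R) : itg f -> itg g ->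
  (forall x, 0 < x -> f x <= g x) -> int0oo f <= int0oo g.
Proof.
move=> i1 i2 fg; rewrite /int0oo /Rintegral fine_le//.
- by apply: integrable_fin_num i1.
- by apply: integrable_fin_num i2.
- apply: le_integral => //.
  by move=> x /set_mem; rewrite RposE => /fg; rewrite lee_fin.
Qed.

Lemma norm_int0oo_le (f g : R -> R) : measurable_fun setT f -> itg g ->
  (forall x, 0 < x -> `|f x| <= g x) -> `|int0oo f| <= int0oo g.
Proof.
move=> mf ig fg; have i := itg_le mf fg ig.
apply: le_trans (le_int0oo (itg_norm i) ig fg).
by apply: le_normr_Rintegral => //; exact: measurable_Rpos.
Qed.

Lemma continuous_derive (F f : R -> R) :
  (forall x, is_derive x (1 : R) F (f x)) -> continuous F.
Proof.
move=> dF x; apply/differentiable_continuous/derivable1_diffP.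
exact: (@ex_derive _ _ _ _ _ _ _ (dF x)).
Qed.

Lemma ge0_int0oo_FTC (f F : R -> R) l :
  (forall x, is_derive x (1 : R) F (f x)) -> continuous f ->
  (forall x, 0 <= x -> 0 <= f x) -> F x @[x --> +oo] --> l ->
  itg f /\ int0oo f = l - F 0.
Proof.
move=> dF cf f0 Fl.
have cF := continuous_derive dF.
have mf : measurable_fun setT f by exact: continuous_measurable_fun.
have key : (\int[mu]_(x in Rpos) (f x)%:E = l%:E - (F 0)%:E)%E.
  rewrite integral_itv_obnd_cbnd; last exact/measurable_EFinP/measurable_funTS.
  apply: (@ge0_continuous_FTC2y R f F 0 l) => //.
  - exact: continuous_subspaceT.
  - by apply: cvg_at_right_filter; exact: cF.
  - by move=> x _; rewrite derive1E; apply: derive_val.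
split; last by rewrite /int0oo /Rintegral key.
apply/integrableP; split; first exact/measurable_EFinP/measurable_funTS.
under eq_integral.
  move=> x /set_mem; rewrite RposE => /ltW/f0 fx; rewrite /= ger0_norm//; over.
by rewrite key -EFinB ltry.
Qed.

(** No sign is required of f: its integrals over [0, n+1] converge by dominated
    convergence, so that boundary terms at infinity of conditionally signed
    integrations by parts can be read off from the limit of F. *)
Lemma int0oo_FTC (f F : R -> R) l :
  (forall x, is_derive x (1 : R) F (f x)) -> continuous f ->
  itg f -> F x @[x --> +oo] --> l -> int0oo f = l - F 0.
Proof.
move=> dF cf i Fl.
have cF := continuous_derive dF.
have mf : measurable_fun setT f by exact: continuous_measurable_fun.
pose fn n (x : R) := f x * \1_(`[0%R, n.+1%:R]%classic : set R) x.
have mI n : measurable (`[0%R, n.+1%:R]%classic : set R) by exact: measurable_itv.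
have mfn n : measurable_fun setT (fn n).
  by apply: measurable_funM => //; exact: measurable_indic.
have step n : (\int[mu]_(x in Rpos) (fn n x)%:E = (F n.+1%:R - F 0)%:E)%E.
  rewrite EFinB -(@continuous_FTC2 R f F 0 n.+1%:R) ?ltr0n//.
  - rewrite -integral_itv_obnd_cbnd; last exact/measurable_EFinP/measurable_funTS.
    rewrite [LHS]integral_mkcond [RHS]integral_mkcond.
    apply: eq_integral => x _; rewrite !epatch_indic /fn /= -!EFinM -mulrA.
    congr (_ * _)%:E; rewrite !indicE !mem_setE !in_itv/= andbT.
    by case: (ltrP 0 x) => [/ltW ->|_]; rewrite ?mulr1 ?mulr0.
  - exact: continuous_subspaceT.
  - split; first by move=> x _; apply: ex_derive.
    + by apply: cvg_at_right_filter; exact: cF.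
    + by apply: cvg_at_left_filter; exact: cF.
  - by move=> x _; rewrite derive1E; apply: derive_val.
have [] := @dominated_convergence _ _ R mu Rpos _ (fun n => EFin \o fn n)
  (EFin \o f) (fun x => `|(f x)%:E|%E).
- exact: measurable_Rpos.
- by move=> n; apply/measurable_EFinP/measurable_funTS; exact: mfn.
- by apply/measurable_EFinP/measurable_funTS.
- apply/aeW => x; rewrite RposE => x0; apply: cvg_near_cst.
  near=> n; rewrite /= /fn indicE mem_setE in_itv/= ltW//=.
  suff -> : x <= n.+1%:R by rewrite mulr1.
  rewrite (@le_trans _ _ n%:R)// ?ler_nat//.
  by near: n; exact: nbhs_infty_ger.
- exact: integrable_abse.
- apply/aeW => x n _; rewrite /= lee_fin /fn indicE normrM ler_piMr//.
  by case: (_ \in _); rewrite ?normr1 ?normr0.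
move=> _ _ dc; have FE : (F n.+1%:R - F 0)%:E @[n --> \oo] --> (l - F 0)%:E.
  apply/cvg_EFin; first exact/nearW.
  apply: cvgB; last exact: cvg_cst.
  apply: (cvg_comp (fun n : nat => n.+1%:R : R) F) Fl.
  by rewrite (cvg_shiftS (fun n : nat => n%:R : R)); exact: cvgr_idn.
rewrite /int0oo /Rintegral (_ : (\int[mu]_(x in _) _)%E = (l - F 0)%:E)//.
apply: cvg_unique FE; first exact: ereal_hausdorff.
rewrite (_ : (fun n => (F n.+1%:R - F 0)%:E) =
  (fun n => (\int[mu]_(x in Rpos) (fn n x)%:E)%E)); first exact: dc.
by apply/funext => n; rewrite step.
Unshelve. all: end_near. Qed.

Lemma ge0_integral_shift (f : R -> R) (a : R) :
  continuous f -> (forall x, 0 <= f x) ->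
  (\int[mu]_x (f (x + a))%:E = \int[mu]_x (f x)%:E)%E.
Proof.
move=> cf f0.
have d x : is_derive x (1 : R) (fun x : R => x + a) 1.
  by apply: is_derive_eq; rewrite addr0.
have dE : derive1 (fun x : R => x + a) = cst 1.
  by apply/funext => x; rewrite derive1E; apply: derive_val.
rewrite (@increasing_ge0_integration_by_substitutionT R (fun x => x + a) f)//.
- by apply: eq_integral => x _; rewrite dE /= mulr1.
- by move=> x y xy; rewrite ltrD2r.
- by rewrite dE => x; exact: cvg_cst.
- by rewrite dE; exact: is_cvg_cst.
- by rewrite dE; exact: is_cvg_cst.
- apply/cvgrNyPle => A; near=> x; rewrite -lerBrDr; near: x.
  by apply: nbhs_ninfty_le; exact: num_real.
- apply/cvgryPge => A; near=> x; rewrite -lerBlDr; near: x.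
  by apply: nbhs_pinfty_ge; exact: num_real.
Unshelve. all: end_near. Qed.

(** Folding at the origin: even functions double, odd parts cancel. *)
Lemma ge0_integral_fold (f : R -> R) :
  continuous f -> (forall x, 0 <= f x) ->
  (\int[mu]_x (f x)%:E = \int[mu]_(x in Rpos) (f x + f (- x))%:E)%E.
Proof.
move=> cf f0.
have mf : measurable_fun setT f by exact: continuous_measurable_fun.
have mfN : measurable_fun setT (f \o -%R) by exact: measurableT_comp.
have lowE : (\int[mu]_(x in `]-oo, (- 0)%R]) (f x)%:E =
             \int[mu]_(x in Rpos) (f (- x))%:E)%E.
  rewrite ge0_integration_by_substitutionNy//; last exact: continuous_subspaceT.
  by rewrite -integral_itv_obnd_cbnd//; apply/measurable_EFinP/measurable_funTS.
rewrite -(setvU `]-oo, (- 0%R)%R]%classic) setCitvl/= ge0_integral_setU//=.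
- rewrite lowE oppr0 -ge0_integralD//.
  + by move=> x _; rewrite lee_fin.
  + by apply/measurable_EFinP/measurable_funTS.
  + by move=> x _; rewrite lee_fin.
  + by apply/measurable_EFinP/measurable_funTS.
- by apply/measurable_EFinP/measurable_funTS.
- by move=> x _; rewrite lee_fin.
- apply/disj_setPS => x [/=]; rewrite !in_itv/= andbT => x1 x2; move: x1.
  by rewrite ltNge x2.
Qed.

(** The derivative of exp has no limit at infinity, so the substitution is made on
    [-n, n] and n is sent to infinity by monotone convergence. *)
Lemma ge0_integral_expR (f : R -> R) : measurable_fun setT f ->
  (forall x, 0 < x -> {for x, continuous f}) -> (forall x, 0 < x -> 0 <= f x) ->
  (\int[mu]_(x in Rpos) (f x)%:E = \int[mu]_x (f (expR x) * expR x)%:E)%E.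
Proof.
move=> mf cf f0.
pose S n := (`[expR (- n%:R), expR n%:R]%classic : set R).
pose T n := (`[(- n%:R), n%:R]%classic : set R).
have mfe : measurable_fun setT (fun x => f (expR x) * expR x).
  by apply: measurable_funM => //; apply: measurableT_comp.
have SE : \bigcup_n S n = Rpos.
  apply/seteqP; split => x.
    by move=> [n _]; rewrite /S /= !in_itv/= andbT => /andP[+ _]; apply/lt_le_trans/expR_gt0.
  rewrite RposE => x0; have [n _ nx] := nbhs_infty_ger `|ln x|.
  exists n => //; have := nx n (leqnn n); rewrite ler_norml => /andP[h1 h2].
  by rewrite /S /= in_itv/= -[x]lnK ?posrE// !ler_expR h1.
have TE : \bigcup_n T n = setT.
  apply/seteqP; split => // x _; have [n _ nx] := nbhs_infty_ger `|x|.
  by exists n => //; have := nx n (leqnn n); rewrite ler_norml /T /= in_itv.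
have dE : derive1 (@expR R) = expR.
  by apply/funext => x; rewrite derive1E; apply: derive_val.
have ST n : (\int[mu]_(x in S n) (f x)%:E = \int[mu]_(x in T n) (f (expR x) * expR x)%:E)%E.
  rewrite /S (@integration_by_substitution_increasing R expR f).
  - by rewrite dE.
  - by rewrite (@le_trans _ _ 0)// oppr_le0.
  - by move=> x y _ _; rewrite ltr_expR.
  - by rewrite dE => x _; exact: continuous_expR.
  - rewrite dE; apply/cvg_ex; exists (expR (- n%:R)).
    by apply: cvg_at_right_filter; exact: continuous_expR.
  - rewrite dE; apply/cvg_ex; exists (expR (n%:R)).
    by apply: cvg_at_left_filter; exact: continuous_expR.
  - split; first by move=> x _; exact: derivable_expR.
    + by apply: cvg_at_right_filter; exact: continuous_expR.
    + by apply: cvg_at_left_filter; exact: continuous_expR.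
  - apply: continuous_in_subspaceT => x /set_mem; rewrite /= in_itv/= => /andP[xe _].
    by apply: cf; apply: lt_le_trans xe; exact: expR_gt0.
have c1 : (\int[mu]_(x in S n) (f x)%:E)%E @[n --> \oo] --> (\int[mu]_(x in Rpos) (f x)%:E)%E.
  rewrite -SE; apply: ge0_nondecreasing_set_cvg_integral.
  - move=> m n mn; apply/subsetPset => x; rewrite /S /= !in_itv/= => /andP[h1 h2].
    rewrite (le_trans _ h1) ?ler_expR ?lerN2 ?ler_nat//=.
    by rewrite (le_trans h2)// ler_expR ler_nat.
  - by move=> n; exact: measurable_itv.
  - by move=> n; apply/measurable_EFinP/measurable_funTS.
  - move=> n x; rewrite /S /= in_itv/= => /andP[h1 _]; rewrite lee_fin f0//.
    by apply: lt_le_trans h1; exact: expR_gt0.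
have c2 : (\int[mu]_(x in T n) (f (expR x) * expR x)%:E)%E @[n --> \oo] -->
    (\int[mu]_x (f (expR x) * expR x)%:E)%E.
  rewrite -TE; apply: ge0_nondecreasing_set_cvg_integral.
  - move=> m n mn; apply/subsetPset => x; rewrite /T /= !in_itv/= => /andP[h1 h2].
    rewrite (le_trans _ h1) ?lerN2 ?ler_nat//=.
    by rewrite (le_trans h2)// ler_nat.
  - by move=> n; exact: measurable_itv.
  - by move=> n; apply/measurable_EFinP/measurable_funTS.
  - by move=> n x _; rewrite lee_fin mulr_ge0 ?expR_ge0// f0// expR_gt0.
apply: cvg_unique c2; first exact: ereal_hausdorff.
by rewrite (_ : (fun n => (\int[mu]_(x in S n) (f x)%:E)%E) =
  fun n => (\int[mu]_(x in T n) (f (expR x) * expR x)%:E)%E) in c1;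
  last by apply/funext => n; exact: ST.
Qed.

(** A continuous function f is (|f| + f) - |f|, a difference of two nonnegative
    continuous functions; this transfers the change of variables from the
    nonnegative case to integrable functions. *)
Lemma continuous_norm_add (f : R -> R) : continuous f ->
  continuous (fun x => `|f x| + f x).
Proof. by move=> cf x; apply: cvgD; [apply: cvg_norm|]; exact: cf. Qed.

Lemma norm_add_ge0 (x : R) : 0 <= `|x| + x.
Proof. by have := ler_norm (- x); rewrite normrN -subr_ge0 opprK. Qed.

Lemma Rintegral_norm_add (D : set R) (f : R -> R) : measurable D ->
  mu.-integrable D (EFin \o f) ->
  \int[mu]_(x in D) f x =
  \int[mu]_(x in D) (`|f x| + f x) - \int[mu]_(x in D) `|f x|.
Proof.
move=> mD i; have iN := integrable_norm i.
rewrite RintegralD// addrAC subrr add0r//.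
Qed.

Lemma integrable_shift (f : R -> R) (a : R) : continuous f ->
  mu.-integrable setT (EFin \o f) ->
  mu.-integrable setT (EFin \o (fun x => f (x + a))).
Proof.
move=> cf /integrableP[mf fi]; apply/integrableP; split.
  apply/measurable_EFinP; apply: continuous_measurable_fun => x.
  apply: (@continuous_comp _ _ _ (fun x => x + a) f); last exact: cf.
  by apply: cvgD; [exact: cvg_id|exact: cvg_cst].
rewrite (ge0_integral_shift a (f := fun x => `|f x|))//.
by move=> x; apply: cvg_norm; exact: cf.
Qed.

Lemma Rintegral_shift (f : R -> R) (a : R) : continuous f ->
  mu.-integrable setT (EFin \o f) ->
  \int[mu]_x f (x + a) = \int[mu]_x f x.
Proof.
move=> cf fi; rewrite Rintegral_norm_add//; last exact: integrable_shift.
rewrite [RHS]Rintegral_norm_add//; congr (_ - _); rewrite /Rintegral.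
  rewrite (ge0_integral_shift a (f := fun x => `|f x| + f x))//.
  - exact: continuous_norm_add.
  - by move=> x; exact: norm_add_ge0.
rewrite (ge0_integral_shift a (f := fun x => `|f x|))//.
by move=> x; apply: cvg_norm; exact: cf.
Qed.

Lemma integrable_fold (f : R -> R) : continuous f ->
  mu.-integrable setT (EFin \o f) <-> itg f /\ itg (fun x => f (- x)).
Proof.
move=> cf.
have cn : continuous (fun x => `|f x|) by move=> x; apply: cvg_norm; exact: cf.
have mf : measurable_fun setT f by exact: continuous_measurable_fun.
have mfN : measurable_fun setT (fun x : R => f (- x)) by exact: measurableT_comp.
have mn (D : set R) (g : R -> R) : measurable_fun setT g -> measurable_fun D (EFin \o (fun x => `|g x| : R)).
  by move=> mg; apply/measurable_EFinP/measurable_funTS/measurableT_comp.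
have foldE : (\int[mu]_x `|(f x)%:E| =
    \int[mu]_(x in Rpos) `|(f x)%:E| + \int[mu]_(x in Rpos) `|(f (- x))%:E|)%E.
  rewrite -ge0_integralD//=; [|exact: mn|exact: mn].
  by rewrite (ge0_integral_fold cn).
have ge (g : R -> \bar R) : (0 <= \int[mu]_(x in Rpos) `|g x|)%E by exact: integral_ge0.
split=> [/integrableP[_]|[/integrableP[_ i1] /integrableP[_ i2]]].
  rewrite foldE => lty; split; apply/integrableP; split.
  - exact/measurable_EFinP/measurable_funTS.
  - by apply: le_lt_trans lty; rewrite leeDl.
  - exact/measurable_EFinP/measurable_funTS.
  - by apply: le_lt_trans lty; rewrite leeDr.
apply/integrableP; split; first exact/measurable_EFinP.
by rewrite foldE lte_add_pinfty.
Qed.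

Lemma Rintegral_fold (f : R -> R) : continuous f ->
  mu.-integrable setT (EFin \o f) ->
  \int[mu]_x f x = int0oo (fun x => f x + f (- x)).
Proof.
move=> cf fi; have [i1 i2] := (integrable_fold cf).1 fi.
have n1 := itg_norm i1; have n2 := itg_norm i2.
rewrite Rintegral_norm_add// {1 2}/Rintegral.
rewrite (ge0_integral_fold (continuous_norm_add cf)); last first.
  by move=> x; exact: norm_add_ge0.
rewrite (@ge0_integral_fold (fun x => `|f x|))//; last first.
  by move=> x; apply: cvg_norm; exact: cf.
rewrite -!/(Rintegral _ _ _) -!/(int0oo _).
rewrite !int0ooD//; [|exact: itgD|exact: itgD].
ring.
Qed.

End Toolkit.

(** * Hyperbolic functions and exponential integrals *)

Section Hyperbolic.
Context {R : realType}.
Notation mu := (@lebesgue_measure R).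
Notation Rpos := (`]0%R, +oo[%classic : set R).
Notation itg f := (mu.-integrable Rpos (EFin \o f)).
Implicit Types x v tau : R.

Lemma continuous_measurable (f : R -> R) : continuous f -> measurable_fun setT f.
Proof. exact: continuous_measurable_fun. Qed.

Lemma is_derive_pow (f : R -> R) (df x : R) (n : nat) :
  is_derive x (1 : R) f df ->
  is_derive x (1 : R) (fun u => f u ^+ n) (n%:R * f x ^+ n.-1 * df).
Proof.
move=> d.
rewrite (_ : (fun u => f u ^+ n) = f ^+ n); first exact: is_deriveX.
by apply/funext => u; rewrite exprfctE.
Qed.

Lemma is_derive_cosh x : is_derive x (1 : R) cosh (sinh x).
Proof.
rewrite /cosh; apply: is_derive_eq.
by rewrite /sinh; rewrite /GRing.scale /=; lra.
Qed.

Lemma is_derive_sinh x : is_derive x (1 : R) sinh (cosh x).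
Proof.
rewrite /sinh; apply: is_derive_eq.
by rewrite /cosh; rewrite /GRing.scale /=; lra.
Qed.

Lemma cosh2_sinh2 x : cosh x ^+ 2 = 1 + sinh x ^+ 2.
Proof.
have h : expR x * expR (- x) = 1 by rewrite -expRD subrr expR0.
rewrite -h /cosh /sinh.
by field.
Qed.

Lemma cosh_gt0 x : 0 < cosh x.
Proof. by rewrite /cosh divr_gt0// addr_gt0// expR_gt0. Qed.

Lemma cosh0 : cosh 0 = 1 :> R.
Proof. by rewrite /cosh oppr0 expR0; lra. Qed.

Lemma sinh0 : sinh 0 = 0 :> R.
Proof. by rewrite /sinh oppr0 expR0; lra. Qed.

Lemma coshN x : cosh (- x) = cosh x.
Proof. by rewrite /cosh opprK addrC. Qed.

Lemma cosh_ge1 x : 1 <= cosh x.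
Proof.
have := cosh2_sinh2 x; have := cosh_gt0 x; have := sqr_ge0 (sinh x); nra.
Qed.

Lemma sinh_le_cosh x : sinh x <= cosh x.
Proof. by rewrite /cosh /sinh; have := expR_gt0 (- x); lra. Qed.

Lemma expR_half_le_cosh x : expR x / 2 <= cosh x.
Proof. by rewrite /cosh; have := expR_gt0 (- x); lra. Qed.

Lemma normr_sinh_le_cosh x : `|sinh x| <= cosh x.
Proof.
rewrite ler_norml sinh_le_cosh andbT /sinh /cosh.
by have := expR_gt0 x; lra.
Qed.

Lemma continuous_cosh : continuous (@cosh R).
Proof. exact: continuous_derive is_derive_cosh. Qed.

Lemma continuous_sinh : continuous (@sinh R).
Proof. exact: continuous_derive is_derive_sinh. Qed.

Lemma sinh_ge0 x : 0 <= x -> 0 <= sinh x.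
Proof.
by move=> x0; rewrite /sinh divr_ge0// subr_ge0 ler_expR; lra.
Qed.

Lemma measurable_cosh : measurable_fun setT (@cosh R).
Proof. by apply: continuous_measurable; exact: continuous_cosh. Qed.

Lemma measurable_sinh : measurable_fun setT (@sinh R).
Proof. by apply: continuous_measurable; exact: continuous_sinh. Qed.

Lemma measurable_cos : measurable_fun setT (@cos R).
Proof. by apply: continuous_measurable; exact: continuous_cos. Qed.

Lemma measurable_sin : measurable_fun setT (@sin R).
Proof. by apply: continuous_measurable; exact: continuous_sin. Qed.

Lemma ge0_of_derive (f df : R -> R) (a : R) : 0 <= a ->
  (forall x, is_derive x (1 : R) f (df x)) ->
  (forall x, 0 <= x <= a -> 0 <= df x) -> 0 <= f a - f 0.
Proof.
move=> a0 d df0; have [|c] := @MVT_segment R f df 0 a a0 (fun x _ => d x).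
  exact/continuous_subspaceT/(continuous_derive d).
by rewrite in_itv/= => /df0 dc ->; rewrite subr0 mulr_ge0.
Qed.

Lemma sinh_ge x : 0 <= x -> x <= sinh x.
Proof.
move=> x0; rewrite -subr_ge0.
have d y : is_derive y (1 : R) (fun y => sinh y - y) (cosh y - 1).
  have ds := is_derive_sinh y.
  by apply: is_derive_eq.
have := ge0_of_derive x0 d; rewrite sinh0 subr0 subr0; apply => y _.
by rewrite subr_ge0 cosh_ge1.
Qed.

Lemma sinh_le_mul_cosh x : 0 <= x -> sinh x <= x * cosh x.
Proof.
move=> x0; rewrite -subr_ge0.
have d y : is_derive y (1 : R) (fun y => y * cosh y - sinh y) (y * sinh y).
  have ds := is_derive_sinh y; have dc := is_derive_cosh y.
  by apply: is_derive_eq; rewrite /GRing.scale/=; ring.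
have := ge0_of_derive x0 d; rewrite sinh0 mul0r subr0 subr0; apply => y /andP[y0 _].
by rewrite mulr_ge0// sinh_ge0.
Qed.

Lemma sin_le_id x : 0 <= x -> sin x <= x.
Proof.
move=> x0; rewrite -subr_ge0.
have d y : is_derive y (1 : R) (fun y => y - sin y) (1 - cos y).
  by apply: is_derive_eq.
have := ge0_of_derive x0 d; rewrite sin0 subr0 subr0; apply => y _.
by rewrite subr_ge0 cos_le1.
Qed.

Lemma mul_cos_le_sin x : 0 <= x <= pi / 2 -> x * cos x <= sin x.
Proof.
move=> /andP[x0 xpi]; rewrite -subr_ge0.
have d y : is_derive y (1 : R) (fun y => sin y - y * cos y) (y * sin y).
  by apply: is_derive_eq; rewrite /GRing.scale/=; ring.
have := ge0_of_derive x0 d; rewrite sin0 mul0r subr0 subr0; apply => y /andP[y0 yx].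
rewrite mulr_ge0// sin_ge0_pi// y0 /=.
by have := pi_ge0 R; lra.
Qed.

(** With [cos_ge_sqr], this controls 1 - cos (tau v) by tau^2 (cosh v - 1), which
    only lowers the exponent of the weight 1/(1 + cosh v). *)
Lemma cosh_ge_sqr v : v ^+ 2 / 2 <= cosh v - 1.
Proof.
wlog v0 : v / 0 <= v.
  by move=> H; have [/H//|/ltW v0] := leP 0 v; rewrite -coshN -sqrrN H// oppr_ge0.
rewrite -subr_ge0.
have d y : is_derive y (1 : R) (fun y => cosh y - 1 - y ^+ 2 / 2) (sinh y - y).
  have dc := is_derive_cosh y.
  by apply: is_derive_eq; rewrite /GRing.scale/=; field.
have := ge0_of_derive v0 d; rewrite cosh0 subrr expr0n/= mul0r subr0 subr0.
by apply => y /andP[y0 _]; rewrite subr_ge0 sinh_ge.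
Qed.

(** With [mul_cos_le_sin], this controls the deviation of cosh (2 tau v) from 1 by
    the loss of mass when cos v ^ n is multiplied by cos v ^ 2. *)
Lemma cosh_le_sqr v : cosh v - 1 <= v ^+ 2 * cosh v.
Proof.
wlog v0 : v / 0 <= v.
  by move=> H; have [/H//|/ltW v0] := leP 0 v; rewrite -coshN -sqrrN H// oppr_ge0.
rewrite -subr_ge0.
have d y : is_derive y (1 : R) (fun y => y ^+ 2 * cosh y - (cosh y - 1))
   (2 * y * cosh y + y ^+ 2 * sinh y - sinh y).
  have dc := is_derive_cosh y.
  by apply: is_derive_eq; rewrite /GRing.scale/=; ring.
have := ge0_of_derive v0 d; rewrite cosh0 subrr expr0n/= mul0r subr0 subr0.
apply => y /andP[y0 _].
have := sinh_le_mul_cosh y0; have := sinh_ge0 y0; have := cosh_ge1 y.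
have := sqr_ge0 y; nra.
Qed.

Lemma cos_ge_sqr v : 1 - v ^+ 2 / 2 <= cos v.
Proof.
wlog v0 : v / 0 <= v.
  by move=> H; have [/H//|/ltW v0] := leP 0 v; rewrite -cosN -sqrrN H// oppr_ge0.
rewrite -subr_ge0.
have d y : is_derive y (1 : R) (fun y => cos y - (1 - y ^+ 2 / 2)) (y - sin y).
  by apply: is_derive_eq; rewrite /GRing.scale/=; field.
have := ge0_of_derive v0 d; rewrite cos0 expr0n/= mul0r subr0 subrr subr0.
by apply => y /andP[y0 _]; rewrite subr_ge0 sin_le_id.
Qed.

Lemma expRN_cvg0 (c : R) : 0 < c -> expR (- (c * x)) @[x --> +oo] --> (0 : R).
Proof.
move=> c0; apply: (cvg_comp (fun x => c * x) (fun x => expR (- x))).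
  exact: gt0_cvgMry.
exact: cvgr_expR.
Qed.

Lemma itg_expRN (c : R) : 0 < c -> itg (fun x => expR (- (c * x))).
Proof.
move=> c0.
have d x : is_derive x (1 : R) (fun x => - c^-1 * expR (- (c * x))) (expR (- (c * x))).
  by apply: is_derive_eq; rewrite /GRing.scale/=; field; rewrite gt_eqF.
have dd x : is_derive x (1 : R) (fun x => expR (- (c * x))) (- c * expR (- (c * x))).
  by apply: is_derive_eq; rewrite /GRing.scale/=; ring.
have [] // := @ge0_int0oo_FTC R (fun x => expR (- (c * x))) _ 0 d (continuous_derive dd).
rewrite -(mulr0 (- c^-1)); apply: cvgM; first exact: cvg_cst.
exact: expRN_cvg0.
Qed.

Lemma pow_le_expR (n : nat) (c x : R) : 0 < c -> 0 <= x ->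
  x ^+ n <= n`!%:R / c ^+ n * expR (c * x).
Proof.
move=> c0 x0; have cx : 0 <= c * x by rewrite mulr_ge0// ltW.
have h : (c * x) ^+ n <= n`!%:R * expR (c * x).
  rewrite -ler_pdivrMl ?ltr0n ?fact_gt0// mulrC.
  case: n => [|n]; last by rewrite (le_trans _ (expR_ge1Dxn n cx))// lerDr.
  by rewrite expr0 fact0 mul1r invr1 -[leLHS]expR0 ler_expR.
rewrite mulrAC ler_pdivlMr ?exprn_gt0// mulrC -exprMn//.
Qed.

Lemma int_powexp (n : nat) (c : R) : 0 < c ->
  itg (fun u => u ^+ n * expR (- (c * u))) /\
  int0oo (fun u => u ^+ n * expR (- (c * u))) = n`!%:R / c ^+ n.+1.
Proof.
move=> c0; have c20 : 0 < c / 2 by lra.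
have bnd m u : 0 <= u -> u ^+ m * expR (- (c * u)) <=
    m`!%:R / (c / 2) ^+ m * expR (- (c / 2 * u)).
  move=> u0; have h := pow_le_expR m c20 u0.
  rewrite -(ler_pM2r (expR_gt0 (- (c * u)))) -[leRHS]mulrA -expRD in h.
  by rewrite (_ : c / 2 * u + - (c * u) = - (c / 2 * u)) in h; last lra.
have mfu m : measurable_fun setT (fun u : R => u ^+ m * expR (- (c * u))).
  by apply: measurable_funM => //; apply: measurableT_comp => //; apply: measurableT_comp.
have ig m : itg (fun u => u ^+ m * expR (- (c * u))).
  apply: itg_le (itgZ (m`!%:R / (c / 2) ^+ m) (itg_expRN c20)) => // u u0.
  rewrite ger0_norm; first exact/bnd/ltW.
  by rewrite mulr_ge0 ?expR_ge0// exprn_ge0// ltW.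
have cpe m : continuous (fun u : R => u ^+ m * expR (- (c * u))).
  have dd x : is_derive x (1 : R) (fun x => expR (- (c * x))) (- c * expR (- (c * x))).
    by apply: is_derive_eq; rewrite /GRing.scale/=; ring.
  by move=> x; apply: cvgM; [exact: exprn_continuous|exact: (continuous_derive dd)].
have lim m : u ^+ m * expR (- (c * u)) @[u --> +oo] --> (0 : R).
  apply: (@squeeze_cvgr _ _ _ _ (cst 0) (fun u => m`!%:R / (c / 2) ^+ m * expR (- (c / 2 * u)))).
  - near=> u; have u0 : 0 <= u by near: u; apply: nbhs_pinfty_ge; exact: num_real.
    by rewrite bnd// mulr_ge0 ?exprn_ge0 ?expR_ge0.
  - exact: cvg_cst.
  - rewrite -[0 in X in _ --> X](mulr0 (m`!%:R / (c / 2) ^+ m)).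
    by apply: cvgM; [exact: cvg_cst|exact: expRN_cvg0].
split; first exact: ig.
elim: n => [|n IH].
  have d x : is_derive x (1 : R) (fun x => - c^-1 * expR (- (c * x))) (x ^+ 0 * expR (- (c * x))).
    by apply: is_derive_eq; rewrite /GRing.scale/=; field; rewrite gt_eqF.
  rewrite (int0oo_FTC d _ (ig 0%N) (l := 0)).
  - by rewrite mulr0 oppr0 expR0 fact0; field; rewrite gt_eqF.
  - exact: cpe.
  - rewrite -(mulr0 (- c^-1)); apply: cvgM; first exact: cvg_cst.
    exact: expRN_cvg0.
have d u : is_derive u (1 : R) (fun u => u ^+ n.+1 * expR (- (c * u)))
   (n.+1%:R * (u ^+ n * expR (- (c * u))) + - c * (u ^+ n.+1 * expR (- (c * u)))).
  have dX := is_derive_pow n.+1 (is_derive_id u (1 : R)).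
  by apply: is_derive_eq; rewrite /GRing.scale/=; ring.
have := int0oo_FTC d _ _ (lim n.+1).
rewrite int0ooD ?int0ooZ ?IH; [|exact: ig|exact: ig|exact: itgZ|exact: itgZ].
rewrite expr0n/= mul0r subrr => H.
have {H} : n.+1%:R * (n`!%:R / c ^+ n.+1) +
    - c * int0oo (fun x : R => x ^+ n.+1 * expR (- (c * x))) = 0.
  apply: H; last by apply: itgD; exact: itgZ.
  move=> x; apply: cvgD; apply: cvgM;
    [exact: cvg_cst|exact: cpe|exact: cvg_cst|exact: cpe].
move=> H; apply: (mulfI (lt0r_neq0 c0)); rewrite factS natrM !exprS.
move: H; rewrite !exprS => /eqP; rewrite mulNr subr_eq0 => /eqP <-.
by field; rewrite expf_neq0 gt_eqF.
Unshelve. all: end_near. Qed.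

End Hyperbolic.

(** * The cosine transform of 1/(1 + cosh v) *)

Section Wallis.
Context {R : realType}.
Notation mu := (@lebesgue_measure R).
Notation Rpos := (`]0%R, +oo[%classic : set R).
Notation itg f := (mu.-integrable Rpos (EFin \o f)).
Implicit Types x v tau : R.

Section WallisTau.
Variable tau : R.
Definition wallis (n : nat) : R :=
  \int[mu]_(v in `[0, pi / 2]) (cosh (2 * tau * v) * cos v ^+ n).

Notation J := wallis.

Lemma pi2_gt0 : 0 < pi / 2 :> R. Proof. by rewrite divr_gt0// pi_gt0. Qed.

Lemma segment_FTC (f F : R -> R) (a b : R) : a < b ->
  (forall x, is_derive x (1 : R) F (f x)) -> continuous f ->
  \int[mu]_(x in `[a, b]) f x = F b - F a.
Proof.
move=> ab dF cf; have cF := continuous_derive dF.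
rewrite /Rintegral (@continuous_FTC2 R f F a b)//.
- exact: continuous_subspaceT.
- split; first by move=> x _; apply: ex_derive.
  + by apply: cvg_at_right_filter; exact: cF.
  + by apply: cvg_at_left_filter; exact: cF.
- by move=> x _; rewrite derive1E; apply: derive_val.
Qed.

Lemma segment_integrable (f : R -> R) (a b : R) : continuous f ->
  mu.-integrable `[a, b] (EFin \o f).
Proof.
move=> cf; apply: continuous_compact_integrable; first exact: segment_compact.
exact: continuous_subspaceT.
Qed.

Lemma continuous_mulr (f g : R -> R) : continuous f -> continuous g ->
  continuous (fun x => f x * g x).
Proof. by move=> cf cg x; apply: cvgM; [exact: cf|exact: cg]. Qed.

Lemma continuous_wallis (n : nat) :
  continuous (fun v : R => cosh (2 * tau * v) * cos v ^+ n).
Proof.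
apply: continuous_mulr => x.
  apply: (@continuous_comp _ _ _ (fun v => 2 * tau * v) cosh); last exact: continuous_cosh.
  by apply: cvgM; [exact: cvg_cst|exact: cvg_id].
apply: (@continuous_comp _ _ _ (@cos R) (fun v => v ^+ n)); first exact: continuous_cos.
exact: exprn_continuous.
Qed.

(** Wallis' integrals with the extra factor cosh (2 tau v), an eigenfunction of
    the second derivative: two integrations by parts trade it for a polynomial
    factor in tau. *)
Lemma wallis_rec (n : nat) :
  (4 * tau ^+ 2 + n.+2%:R ^+ 2) * J n.+2 = n.+2%:R * n.+1%:R * J n.
Proof.
pose f v : R := (4 * tau ^+ 2 + n.+2%:R ^+ 2) * (cosh (2 * tau * v) * cos v ^+ n.+2)
   + - (n.+2%:R * n.+1%:R) * (cosh (2 * tau * v) * cos v ^+ n).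
have d v : is_derive v (1 : R) (fun v => 2 * tau * sinh (2 * tau * v) * cos v ^+ n.+2 +
   n.+2%:R * cosh (2 * tau * v) * (cos v ^+ n.+1 * sin v)) (f v).
  have ds := is_derive_sinh (2 * tau * v); have dc := is_derive_cosh (2 * tau * v).
  have dl : is_derive v (1 : R) (fun v => 2 * tau * v) (2 * tau).
    by apply: is_derive_eq; rewrite /GRing.scale/=; ring.
  have d1 : is_derive v (1 : R) (fun v => sinh (2 * tau * v)) (cosh (2 * tau * v) * (2 * tau)).
    exact: is_derive1_comp.
  have d2 : is_derive v (1 : R) (fun v => cosh (2 * tau * v)) (sinh (2 * tau * v) * (2 * tau)).
    exact: is_derive1_comp.
  have p1 := is_derive_pow n.+2 (is_derive_cos v).
  have p2 := is_derive_pow n.+1 (is_derive_cos v).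
  apply: is_derive_eq; rewrite /GRing.scale/= /f !exprS.
  have := cos2Dsin2 v; set c := cos v; set s := sin v => cs.
  have -> : n.+2%:R = n%:R + 2 :> R by rewrite -natr1 -natr1; ring.
  have -> : n.+1%:R = n%:R + 1 :> R by rewrite -natr1.
  have s2 : s ^+ 2 = 1 - c ^+ 2 by rewrite -cs; ring.
  by move: s2; rewrite expr2 => s2; ring: s2.
have cf : continuous f.
  move=> x; apply: cvgD; apply: cvgM; try exact: cvg_cst; exact: continuous_wallis.
have := segment_FTC pi2_gt0 d cf.
rewrite /f RintegralD//; last 2 first.
- apply: segment_integrable => x; apply: cvgM; try exact: cvg_cst; exact: continuous_wallis.
- apply: segment_integrable => x; apply: cvgM; try exact: cvg_cst; exact: continuous_wallis.
rewrite !RintegralZl//; [|exact/segment_integrable/continuous_wallis..].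
rewrite -/(J n.+2) -/(J n) cos_pihalf sin0 mulr0 sinh0 !expr0n /= !mulr0 !mul0r !mulr0 !addr0 subrr.
by rewrite mulNr => /eqP; rewrite subr_eq0 => /eqP.
Qed.

Lemma wallis0 : tau * J 0 = sinh (pi * tau) / 2.
Proof.
have d v : is_derive v (1 : R) (fun v => sinh (2 * tau * v) / 2) (tau * (cosh (2 * tau * v) * cos v ^+ 0)).
  have ds := is_derive_sinh (2 * tau * v).
  have dl : is_derive v (1 : R) (fun v => 2 * tau * v) (2 * tau).
    by apply: is_derive_eq; rewrite /GRing.scale/=; ring.
  have d1 : is_derive v (1 : R) (fun v => sinh (2 * tau * v)) (cosh (2 * tau * v) * (2 * tau)).
    exact: is_derive1_comp.
  by apply: is_derive_eq; rewrite /GRing.scale/= expr0; field.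
have := segment_FTC pi2_gt0 d; rewrite mulr0 sinh0 mul0r subr0.
rewrite (_ : 2 * tau * (pi / 2) = pi * tau); last by field.
move=> <-; first by rewrite RintegralZl//; exact/segment_integrable/continuous_wallis.
by apply: continuous_mulr; [move=> x; exact: cvg_cst|exact: continuous_wallis].
Qed.

End WallisTau.

Lemma wallis00 : wallis 0 0 = pi / 2.
Proof.
rewrite /wallis; under eq_Rintegral do rewrite mulr0 mul0r cosh0 expr0 mulr1.
rewrite Rintegral_cst//= lebesgue_measure_itv/= lte_fin pi2_gt0 mul1r -EFinB/=.
by rewrite subr0.
Qed.

Lemma wallis_gt0 n : 0 < wallis 0 n.*2.
Proof.
elim: n => [|n IH]; first by rewrite wallis00 pi2_gt0.
have := wallis_rec 0 n.*2; rewrite expr0n/= mulr0 add0r doubleS => h.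
have h1 : 0 < (n.*2).+2%:R * (n.*2).+1%:R * wallis 0 n.*2 by rewrite !mulr_gt0// ltr0n.
by move: h1; rewrite -h pmulr_rgt0// exprn_gt0// ltr0n.
Qed.

Lemma le_segment (f g : R -> R) (a b : R) : continuous f -> continuous g ->
  (forall x, a <= x <= b -> f x <= g x) ->
  \int[mu]_(x in `[a, b]) f x <= \int[mu]_(x in `[a, b]) g x.
Proof.
move=> cf cg fg; have i1 := segment_integrable a b cf; have i2 := segment_integrable a b cg.
rewrite /Rintegral fine_le//.
- by apply: integrable_fin_num i1.
- by apply: integrable_fin_num i2.
- apply: le_integral => // x /set_mem; rewrite /= in_itv/= => /fg.
  by rewrite lee_fin.
Qed.

Lemma cosh_le (a b : R) : 0 <= a -> a <= b -> cosh a <= cosh b.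
Proof.
move=> a0 ab; rewrite -subr_ge0.
have [|c] := @MVT_segment R cosh sinh a b ab (fun x _ => is_derive_cosh x).
  exact/continuous_subspaceT/continuous_cosh.
rewrite in_itv/= => /andP[ac _] ->.
by rewrite mulr_ge0 ?subr_ge0// sinh_ge0// (le_trans a0).
Qed.

Lemma wallis_ge tau n : wallis 0 n.*2 <= wallis tau n.*2.
Proof.
apply: le_segment; [exact: continuous_wallis|exact: continuous_wallis|move=> v v0].
rewrite mulr0 mul0r cosh0 ler_wpM2r// ?cosh_ge1//.
by rewrite -muln2 mulnC exprM exprn_ge0// sqr_ge0.
Qed.

(** Since cosh (2 tau v) - 1 <= C v^2 and v cos v <= sin v, the excess over the
    case tau = 0 is at most C times the integral of sin^2 v cos^{2n} v, which the
    recursion at tau = 0 evaluates. *)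
Lemma wallis_le tau n : 0 <= tau ->
  wallis tau n.+1.*2 <= wallis 0 n.+1.*2 *
    (1 + (2 * tau) ^+ 2 * cosh (pi * tau) / (n.*2).+1%:R).
Proof.
move=> tau0; pose C := (2 * tau) ^+ 2 * cosh (pi * tau).
have C0 : 0 <= C by rewrite mulr_ge0 ?sqr_ge0// ltW// cosh_gt0.
have cc m := @continuous_wallis 0 m.
apply: (@le_trans _ _ (wallis 0 n.+1.*2 + C * (wallis 0 n.*2 - wallis 0 n.+1.*2))).
  rewrite /wallis -RintegralB//; [|exact: segment_integrable..].
  have cB : continuous (fun v : R => cosh (2 * 0 * v) * cos v ^+ n.*2 - cosh (2 * 0 * v) * cos v ^+ n.+1.*2).
    by move=> x; apply: cvgB; exact: cc.
  have cCB : continuous (fun v : R => C * (cosh (2 * 0 * v) * cos v ^+ n.*2 - cosh (2 * 0 * v) * cos v ^+ n.+1.*2)).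
    by move=> x; apply: cvgM; [exact: cvg_cst|exact: cB].
  rewrite -RintegralZl//; last exact: segment_integrable.
  rewrite -RintegralD//; [|exact: segment_integrable..].
  apply: le_segment; first exact: continuous_wallis.
    by move=> x; apply: cvgD; [exact: cc|exact: cCB].
  move=> v v0; rewrite mulr0 mul0r cosh0 !mul1r doubleS.
  have p0 : 0 <= cos v ^+ n.*2 by rewrite -muln2 mulnC exprM exprn_ge0// sqr_ge0.
  rewrite -[(n.*2).+2]addn2 exprD; set p := cos v ^+ n.*2 in p0 *.
  have h1 := mul_cos_le_sin v0.
  have /andP[v1 v2] := v0.
  have cv0 : 0 <= cos v by apply: cos_ge0_pihalf; have := pi2_gt0; lra.
  have h2 : v ^+ 2 * cos v ^+ 2 <= 1 - cos v ^+ 2.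
    rewrite -sin2cos2 -exprMn ler_sqr ?nnegrE// ?mulr_ge0//.
    by apply: le_trans h1; rewrite mulr_ge0.
  have h3 := cosh_le_sqr (2 * tau * v).
  have h4 : cosh (2 * tau * v) <= cosh (pi * tau).
    by apply: cosh_le; [rewrite !mulr_ge0|rewrite mulrAC ler_wpM2r//; lra].
  have h5 : cosh (2 * tau * v) - 1 <= C * v ^+ 2.
    apply: (le_trans h3); rewrite exprMn /C; have := cosh_gt0 (2 * tau * v).
    have := sqr_ge0 (2 * tau); have := sqr_ge0 v; have := cosh_gt0 (pi * tau).
    set A := (2 * tau) ^+ 2; set B := v ^+ 2 => a1 a2 a3 a4.
    by rewrite mulrAC ler_wpM2r// ler_wpM2l.
  have h6 : (cosh (2 * tau * v) - 1) * cos v ^+ 2 <= C * (1 - cos v ^+ 2).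
    apply: (@le_trans _ _ (C * (v ^+ 2 * cos v ^+ 2))); last by rewrite ler_wpM2l.
    by rewrite mulrA ler_wpM2r// sqr_ge0.
  have : (cosh (2 * tau * v) - 1) * cos v ^+ 2 * p <= C * (1 - cos v ^+ 2) * p.
    by rewrite ler_wpM2r.
  lra.
have := wallis_rec 0 n.*2; rewrite expr0n/= mulr0 add0r -doubleS => h.
have e : wallis 0 n.*2 - wallis 0 n.+1.*2 = wallis 0 n.+1.*2 / (n.*2).+1%:R.
  have n1 : (n.*2).+1%:R != 0 :> R by rewrite pnatr_eq0.
  have n2 : (n.*2).+2%:R != 0 :> R by rewrite pnatr_eq0.
  apply: (mulfI n1); apply: (mulfI n2); rewrite mulrBr mulrBr !mulrA -h.
  have -> : (n.*2).+2%:R = (n.*2).+1%:R + 1 :> R by rewrite -natr1.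
  by field.
by rewrite e -/C le_eqVlt; apply/orP; left; apply/eqP; ring.
Qed.

(** Half of the square of the hyperbolic secant at v/2; it satisfies a second order
    differential equation, which is what makes its powers tractable. *)
Definition sechsq (v : R) : R := (1 + cosh v)^-1.

Lemma cosh1_gt0 v : 0 < 1 + cosh v.
Proof. by have := cosh_gt0 v; lra. Qed.

Lemma cosh1_neq0 v : 1 + cosh v != 0.
Proof. by rewrite gt_eqF// cosh1_gt0. Qed.

Lemma sechsq_gt0 v : 0 < sechsq v.
Proof. by rewrite invr_gt0 cosh1_gt0. Qed.

Lemma sechsq_le1 v : sechsq v <= 1.
Proof. by rewrite invf_le1 ?cosh1_gt0//; have := cosh_gt0 v; lra. Qed.

Lemma sechsq_le_expR v : sechsq v <= 2 * expR (- v).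
Proof.
rewrite expRN -ler_pdivrMl// -invfM lef_pV2 ?posrE ?mulr_gt0 ?expR_gt0 ?cosh1_gt0//.
have := expR_half_le_cosh v; have := expR_gt0 v; lra.
Qed.

Lemma is_derive_sechsq v : is_derive v (1 : R) sechsq (- sinh v * sechsq v ^+ 2).
Proof.
have dc : is_derive v (1 : R) (fun v => 1 + cosh v) (sinh v).
  have dc := is_derive_cosh v.
  by apply: is_derive_eq; rewrite /GRing.scale/=; ring.
have := @is_deriveV R (fun v => 1 + cosh v) v (sinh v) 1 (cosh1_neq0 v) dc.
rewrite /sechsq => d; apply: is_derive_eq.
by rewrite /GRing.scale/= exprVn; ring.
Qed.

Lemma continuous_sechsq : continuous sechsq.
Proof. exact: continuous_derive is_derive_sechsq. Qed.

Lemma sinh_sechsq v : `|sinh v * sechsq v| <= 1.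
Proof.
rewrite normrM (gtr0_norm (sechsq_gt0 v)) ler_pdivrMr ?cosh1_gt0// mul1r.
by apply: (le_trans (normr_sinh_le_cosh v)); lra.
Qed.

Lemma cosh_sechsq v : cosh v * sechsq v = 1 - sechsq v.
Proof. by rewrite /sechsq; field; exact: cosh1_neq0. Qed.

Lemma sinh2_sechsq2 v : sinh v ^+ 2 * sechsq v ^+ 2 = 1 - 2 * sechsq v.
Proof.
have -> : sinh v ^+ 2 = cosh v ^+ 2 - 1 by rewrite cosh2_sinh2; ring.
by rewrite /sechsq; field; exact: cosh1_neq0.
Qed.

Section Moments.
Variable tau : R.

Definition sechsq_moment (j : nat) : R := int0oo (fun v => cos (tau * v) * sechsq v ^+ j).

Notation m := sechsq_moment.

Lemma is_derive_costau v : is_derive v (1 : R) (fun v => cos (tau * v)) (- tau * sin (tau * v)).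
Proof. by apply: is_derive_eq; rewrite /GRing.scale/=; ring. Qed.

Lemma is_derive_sintau v : is_derive v (1 : R) (fun v => sin (tau * v)) (tau * cos (tau * v)).
Proof. by apply: is_derive_eq; rewrite /GRing.scale/=; ring. Qed.

Lemma continuous_sechsq_moment j : continuous (fun v => cos (tau * v) * sechsq v ^+ j).
Proof.
apply: continuous_mulr; first exact: continuous_derive is_derive_costau.
by move=> x; apply: (@continuous_comp _ _ _ sechsq (fun v => v ^+ j));
  [exact: continuous_sechsq|exact: exprn_continuous].
Qed.

Lemma sechsq_pow_le v j : sechsq v ^+ j.+1 <= 2 * expR (- (1 * v)).
Proof.
rewrite mul1r; apply: le_trans (sechsq_le_expR v); rewrite exprS ger_pMr ?sechsq_gt0//.
by rewrite exprn_ile1 ?sechsq_le1// ltW// sechsq_gt0.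
Qed.

Lemma itg_sechsq_moment j : itg (fun v => cos (tau * v) * sechsq v ^+ j.+1).
Proof.
apply: itg_le (itgZ 2 (itg_expRN (ltr01 : 0 < 1 :> R))).
  by apply: continuous_measurable; exact: continuous_sechsq_moment.
move=> v v0; rewrite normrM -[leRHS]mul1r ler_pM ?cos_max//.
by rewrite ger0_norm ?sechsq_pow_le// exprn_ge0// ltW// sechsq_gt0.
Qed.

(** The second derivative of the j-th power of the weight w is
    j^2 w^j - j(2j+1) w^{j+1}, by [cosh_sechsq] and [sinh2_sechsq2]; two
    integrations by parts turn it into -tau^2 w^j. *)
Lemma sechsq_moment_rec (j : nat) :
  (j.+1%:R ^+ 2 + tau ^+ 2) * m j.+1 = j.+1%:R * (2 * j.+1%:R + 1) * m j.+2.
Proof.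
pose a : R := j.+1%:R.
pose f v : R := (a ^+ 2 + tau ^+ 2) * (cos (tau * v) * sechsq v ^+ j.+1)
   + - (a * (2 * a + 1)) * (cos (tau * v) * sechsq v ^+ j.+2).
(* cos (tau v) times the derivative of w^a, minus its derivative times w^a *)
have d v : is_derive v (1 : R) (fun v => - a * cos (tau * v) * (sinh v * sechsq v ^+ j.+2)
   + tau * (sin (tau * v) * sechsq v ^+ j.+1)) (f v).
  have dc := is_derive_costau v; have ds := is_derive_sintau v.
  have dsh := is_derive_sinh v.
  have p1 := is_derive_pow j.+1 (is_derive_sechsq v).
  have p2 := is_derive_pow j.+2 (is_derive_sechsq v).
  apply: is_derive_eq; rewrite /GRing.scale/= /f !exprS.
  have := cosh_sechsq v; have := sinh2_sechsq2 v.
  have -> : j.+2%:R = a + 1 :> R by rewrite -natr1.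
  rewrite -/a; set w := sechsq v; set s := sinh v; set c := cosh v => r2 r1.
  have {}r2 : s ^+ 2 * w ^+ 2 = 1 - 2 * w by [].
  by ring: r1 r2.
have cf : continuous f.
  by move=> x; apply: cvgD; apply: cvgM;
    [exact: cvg_cst|exact: continuous_sechsq_moment|exact: cvg_cst|exact: continuous_sechsq_moment].
have i1 := itgZ (a ^+ 2 + tau ^+ 2) (itg_sechsq_moment j).
have i2 := itgZ (- (a * (2 * a + 1))) (itg_sechsq_moment j.+1).
have := int0oo_FTC d cf (itgD i1 i2) (l := 0).
rewrite int0ooD// !int0ooZ; [|exact: itg_sechsq_moment..].
rewrite -/(m _) -/(m _) sinh0 mulr0 sin0 !mul0r !mulr0 addr0 subrr => H.
have : (a ^+ 2 + tau ^+ 2) * m j.+1 + - (a * (2 * a + 1)) * m j.+2 = 0.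
  apply: H; apply: norm_cvg0.
  apply: (@squeeze_cvgr _ _ _ _ (cst 0) (fun v => (a + `|tau|) * 2 * expR (- (1 * v)))).
  - near=> v; rewrite normr_ge0 /=.
    have a0 : 0 <= a by rewrite ler0n.
    have w0 := sechsq_gt0 v.
    apply: (@le_trans _ _ ((a + `|tau|) * sechsq v ^+ j.+1)); last first.
      by rewrite -mulrA ler_wpM2l ?sechsq_pow_le// addr_ge0.
    apply: (le_trans (ler_normD _ _)); rewrite mulrDl lerD//.
      rewrite normrM normrM normrN (ger0_norm a0) -mulrA ler_wpM2l//.
      rewrite exprS mulrA normrM mulrA -[leRHS]mul1r ler_pM//.
        by rewrite -[leRHS]mul1r ler_pM ?cos_max ?sinh_sechsq.
      by rewrite ger0_norm// exprn_ge0// ltW.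
    rewrite normrM ler_wpM2l// normrM -[leRHS]mul1r ler_pM ?sin_max//.
    by rewrite ger0_norm// exprn_ge0// ltW.
  - exact: cvg_cst.
  - rewrite -[0 in X in _ --> X](mulr0 ((a + `|tau|) * 2)).
    by apply: cvgM; [exact: cvg_cst|exact: expRN_cvg0].
by rewrite mulNr => /eqP; rewrite subr_eq0 => /eqP.
Unshelve. all: end_near. Qed.

End Moments.

Lemma sechsq_moment01 : sechsq_moment 0 1 = 1.
Proof.
have d v : is_derive v (1 : R) (fun v => sinh v * sechsq v) (cos (0 * v) * sechsq v ^+ 1).
  have dw := is_derive_sechsq v; have ds := is_derive_sinh v.
  apply: is_derive_eq; rewrite /GRing.scale/= mul0r cos0 mul1r expr1.
  have := cosh_sechsq v; have := sinh2_sechsq2 v.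
  set w := sechsq v; set s := sinh v; set c := cosh v => r2 r1.
  by ring: r1 r2.
rewrite /sechsq_moment (int0oo_FTC d (continuous_sechsq_moment (tau:=0) (j:=1)) (itg_sechsq_moment 0 0) (l := 1)).
  by rewrite sinh0 mul0r subr0.
suff h : sinh v * sechsq v - 1 @[v --> +oo] --> (0 : R) by move/subr_cvg0: h.
apply: norm_cvg0.
apply: (@squeeze_cvgr _ _ _ _ (cst 0) (fun v => 2 * expR (- (1 * v)))).
- near=> v; rewrite normr_ge0 /=.
  have v0 : 0 <= v by near: v; apply: nbhs_pinfty_ge; exact: num_real.
  rewrite (_ : sinh v * sechsq v - 1 = - ((1 + expR (- v)) * sechsq v)); last first.
    have := cosh1_neq0 v; rewrite /sechsq /cosh /sinh => h.
    by field; move: h; apply: contra_neq; lra.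
  rewrite normrN ger0_norm; last first.
    by rewrite mulr_ge0 ?addr_ge0 ?expR_ge0// ltW// sechsq_gt0.
  rewrite ler_pdivrMr ?cosh1_gt0// mul1r /cosh.
  have h : expR v * expR (- v) = 1 by rewrite -expRD subrr expR0.
  have := expR_gt0 (- v); nra.
- exact: cvg_cst.
- rewrite -[0 in X in _ --> X](mulr0 2).
  by apply: cvgM; [exact: cvg_cst|exact: expRN_cvg0].
Unshelve. all: end_near. Qed.

Lemma sechsq_moment0_gt0 j : 0 < sechsq_moment 0 j.+1.
Proof.
elim: j => [|j IH]; first by rewrite sechsq_moment01.
have := sechsq_moment_rec 0 j; rewrite expr0n/= addr0 => h.
have : 0 < j.+1%:R ^+ 2 * sechsq_moment 0 j.+1 by rewrite mulr_gt0// exprn_gt0.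
by rewrite h pmulr_rgt0// mulr_gt0.
Qed.

Lemma sechsq_moment_le tau j : sechsq_moment tau j.+1 <= sechsq_moment 0 j.+1.
Proof.
apply: le_int0oo; [exact: itg_sechsq_moment|exact: itg_sechsq_moment|move=> v _].
by rewrite mul0r cos0 ler_wpM2r ?cos_le1// exprn_ge0// ltW// sechsq_gt0.
Qed.

(** In terms of the weight w, the bound cos (tau v) >= 1 - tau^2 (cosh v - 1) reads
    cos (tau v) w >= (1 + 2 tau^2) w - tau^2, so that the recursion at tau = 0
    evaluates the lower bound. *)
Lemma sechsq_moment_ge tau j :
  sechsq_moment 0 j.+2 * (1 - tau ^+ 2 / j.+1%:R) <= sechsq_moment tau j.+2.
Proof.
have := sechsq_moment_rec 0 j; rewrite expr0n/= addr0 => h.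
have a0 : 0 < j.+1%:R :> R by [].
have e : sechsq_moment 0 j.+2 * (1 - tau ^+ 2 / j.+1%:R) =
    (1 + 2 * tau ^+ 2) * sechsq_moment 0 j.+2 + - tau ^+ 2 * sechsq_moment 0 j.+1.
  have -> : sechsq_moment 0 j.+1 = (2 * j.+1%:R + 1) / j.+1%:R * sechsq_moment 0 j.+2.
    apply: (mulfI (expf_neq0 2 (lt0r_neq0 a0))); rewrite h.
    by field; rewrite gt_eqF.
  by field; rewrite gt_eqF.
rewrite e /sechsq_moment -!int0ooZ; [|exact: itg_sechsq_moment..].
have i1 := itgZ (1 + 2 * tau ^+ 2) (itg_sechsq_moment 0 j.+1).
have i2 := itgZ (- tau ^+ 2) (itg_sechsq_moment 0 j).
rewrite -int0ooD//; apply: le_int0oo; [exact: itgD|exact: itg_sechsq_moment|move=> v _].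
rewrite mul0r cos0 !mul1r [sechsq v ^+ j.+2]exprS.
have w0 := sechsq_gt0 v; have p0 : 0 < sechsq v ^+ j.+1 by rewrite exprn_gt0.
set p := sechsq v ^+ j.+1 in p0 *.
have h1 := cos_ge_sqr (tau * v); have h2 := cosh_ge_sqr v.
have h3 : 1 - tau ^+ 2 * (cosh v - 1) <= cos (tau * v).
  apply: le_trans h1; rewrite lerD2l lerN2 exprMn -mulrA ler_wpM2l ?sqr_ge0//.
have r1 := cosh_sechsq v.
have -> : (1 + 2 * tau ^+ 2) * (sechsq v * p) + - tau ^+ 2 * p =
  (1 - tau ^+ 2 * (cosh v - 1)) * (sechsq v * p).
  by ring: r1.
by rewrite ler_wpM2r// mulr_ge0// ltW.
Qed.

(** The factor j^2 + tau^2 divides in one recursion and multiplies in the other: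
    it drops out of the product, and the remaining factor does not depend on tau. *)
Lemma wallis_sechsq_rec tau (n : nat) :
  sechsq_moment tau n.+2 * wallis tau n.+1.*2 =
  (2 * n.+1%:R - 1) / (2 * (2 * n.+1%:R + 1)) * (sechsq_moment tau n.+1 * wallis tau n.*2).
Proof.
pose a : R := n.+1%:R; have a0 : 0 < a by rewrite ltr0n.
have h1 := sechsq_moment_rec tau n; have h2 := wallis_rec tau n.*2.
rewrite doubleS.
have e2 : (n.*2).+2%:R = 2 * a :> R by rewrite /a -doubleS -muln2 natrM mulrC.
have e1 : (n.*2).+1%:R = 2 * a - 1 :> R by rewrite -e2 -[in RHS]natr1 addrK.
rewrite e1 e2 in h2; rewrite -/a in h1 *.
have b0 : 0 < a ^+ 2 + tau ^+ 2 by rewrite ltr_wpDr ?sqr_ge0// exprn_gt0.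
have -> : sechsq_moment tau n.+2 = (a ^+ 2 + tau ^+ 2) * sechsq_moment tau n.+1 / (a * (2 * a + 1)).
  by rewrite h1 mulrC mulKf//; rewrite mulf_neq0// gt_eqF//; lra.
have -> : wallis tau (n.*2).+2 = 2 * a * (2 * a - 1) * wallis tau n.*2 / (4 * (a ^+ 2 + tau ^+ 2)).
  rewrite -h2 (_ : 4 * tau ^+ 2 + (2 * a) ^+ 2 = 4 * (a ^+ 2 + tau ^+ 2)); last by ring.
  by rewrite mulrC mulKf// mulf_neq0// gt_eqF//; lra.
by field; rewrite !gt_eqF//; lra.
Qed.

Lemma wallis_sechsq_ratio tau (n : nat) :
  sechsq_moment tau n.+1 * wallis tau n.*2 * (sechsq_moment 0 1 * wallis 0 0) =
  sechsq_moment tau 1 * wallis tau 0 * (sechsq_moment 0 n.+1 * wallis 0 n.*2).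
Proof.
elim: n => [|n IH]; first by rewrite mulrC.
rewrite !wallis_sechsq_rec; set q := _ / _.
by rewrite -[LHS]mulrA IH; ring.
Qed.

(** The ratio between the product of the two integrals at tau and at 0 is the same
    for all n by [wallis_sechsq_ratio]; it tends to 1 because both weights concentrate
    at the origin, so it equals 1 at n = 0, where the second integral is
    sinh (pi tau)/(2 tau). *)
Lemma sechsq_moment_sinh tau : 0 < tau ->
  sechsq_moment tau 1 * sinh (pi * tau) = pi * tau.
Proof.
move=> tau0.
(* pi/2 is the value of the product of the two integrals at tau = 0 *)
pose y := sechsq_moment tau 1 * wallis tau 0 / (pi / 2).
have p0 := pi2_gt0.
suff y1 : y = 1.
  have : sechsq_moment tau 1 * wallis tau 0 = pi / 2.
    by rewrite -[LHS](divfK (lt0r_neq0 p0)) -/y y1 mul1r.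
  move=> h; have := wallis0 tau => h2.
  have -> : sinh (pi * tau) = 2 * (tau * wallis tau 0) by rewrite h2; field.
  rewrite (_ : _ * _ = 2 * tau * (sechsq_moment tau 1 * wallis tau 0)); last by ring.
  by rewrite h; field.
pose C := (2 * tau) ^+ 2 * cosh (pi * tau).
have C0 : 0 <= C by rewrite mulr_ge0 ?sqr_ge0// ltW// cosh_gt0.
have key n : (0 <= 1 - tau ^+ 2 / n.+1%:R -> 1 - tau ^+ 2 / n.+1%:R <= y) /\ y <= 1 + C / (n.*2).+1%:R.
  have := wallis_sechsq_ratio tau n.+1; rewrite sechsq_moment01 wallis00 mul1r.
  set A := sechsq_moment tau n.+2; set B := wallis tau n.+1.*2.
  set A0 := sechsq_moment 0 n.+2; set B0 := wallis 0 n.+1.*2 => H.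
  have A00 : 0 < A0 by exact: sechsq_moment0_gt0.
  have B00 : 0 < B0 by exact: wallis_gt0.
  have yE : y * (A0 * B0) = A * B.
    apply: (mulIf (lt0r_neq0 p0)); rewrite H /y.
    by rewrite mulrAC divfK// lt0r_neq0.
  have hA1 := sechsq_moment_ge tau n; have hA2 := sechsq_moment_le tau n.+1.
  have hB1 := wallis_ge tau n.+1; have hB2 := wallis_le n (ltW tau0).
  rewrite -/A -/A0 in hA1 hA2; rewrite -/B -/B0 -/C in hB1 hB2.
  clearbody A B A0 B0.
  have AB0 : 0 < A0 * B0 by rewrite mulr_gt0.
  have B0' : 0 < B by apply: lt_le_trans hB1.
  have C1 : 0 <= C / (n.*2).+1%:R by rewrite divr_ge0.
  split; first move=> t0; rewrite -(ler_pM2r AB0) yE.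
    rewrite mulrA (mulrC _ A0); apply: ler_pM => //; last exact: ltW.
    by rewrite mulr_ge0// ltW.
  have A1 : A * B <= A0 * B by rewrite ler_pM2r.
  by apply: (le_trans A1); rewrite mulrCA ler_pM2l// mulrC.
have lim1 (c : R) (g : nat -> nat) : (forall n, n <= g n)%N ->
   1 + c / (g n).+1%:R @[n --> \oo] --> (1 : R).
  move=> gn; rewrite -[X in _ --> X]addr0; apply: cvgD; first exact: cvg_cst.
  rewrite -[X in _ --> X](mulr0 c); apply: cvgM; first exact: cvg_cst.
  apply: (@squeeze_cvgr _ _ _ _ (cst 0) (fun n => n.+1%:R^-1)).
  - near=> n; rewrite invr_ge0 ler0n/= lef_pV2 ?posrE// ler_nat ltnS//.
  - exact: cvg_cst.
  - exact: cvg_harmonic.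
apply/eqP; rewrite eq_le; apply/andP; split.
- have l2 := lim1 C double (fun n => eq_ind_r (fun k => n <= k)%N (leq_addr n n) (esym (addnn n))).
  by apply: (ler_cvg_to (cvg_cst y) l2); apply: nearW => n; exact: (key n).2.
- have l2 := lim1 (- tau ^+ 2) id (fun n => leqnn n).
  apply: (ler_cvg_to l2 (cvg_cst y)); near=> n; rewrite mulNr.
  apply: (key n).1; rewrite subr_ge0 ler_pdivrMr// mul1r.
  rewrite (@le_trans _ _ n%:R)// ?ler_nat//.
  by near: n; exact: nbhs_infty_ger.
Unshelve. all: end_near. Qed.

End Wallis.

(** * The Macdonald function and the polynomials p_n *)

Section Macdonald.
Context {R : realType}.
Notation mu := (@lebesgue_measure R).
Notation Rpos := (`]0%R, +oo[%classic : set R).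
Notation itg f := (mu.-integrable Rpos (EFin \o f)).
Implicit Types x v tau : R.

Lemma int0oo_swap (f : R -> R -> R) (h : R -> R) :
  measurable_fun setT (fun z : R * R => f z.1 z.2) ->
  (forall y, 0 < y -> itg (f ^~ y) /\ int0oo (fun x => `|f x y|) <= h y) ->
  itg h ->
  [/\ itg (fun x => int0oo (f x)), itg (fun y => int0oo (f ^~ y)) &
     int0oo (fun x => int0oo (f x)) = int0oo (fun y => int0oo (f ^~ y))].
Proof.
move=> mf H ih; apply: (Rintegral_swap measurable_Rpos measurable_Rpos mf _ ih) => y.
by rewrite RposE; exact: H.
Qed.

(** [macdonald_im] with the complex exponentials multiplied out. *)
Definition besselK tau x : R := int0oo (fun v => expR (- (x * cosh v)) * cos (tau * v)).

Lemma macdonald_imE tau x : macdonald_im tau x = besselK tau x.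
Proof.
rewrite /macdonald_im /macdonald /cint0oo /besselK /=.
apply: int0oo_eq => v _.
rewrite /ccosh /cexp /= cosN.
rewrite !(mul0r, mulr0, addr0, add0r, subr0, oppr0, expR0, mul1r, expr0n)/=.
by field.
Qed.

Lemma expRN_le_inv (z : R) : 0 < z -> expR (- z) <= z^-1.
Proof.
move=> z0; rewrite expRN lef_pV2 ?posrE ?expR_gt0//.
by apply: le_trans (expR_ge1Dx z); rewrite lerDr.
Qed.

Lemma expRcosh_le x v : 0 < x -> expR (- (x * cosh v)) <= 2 / x * expR (- (1 * v)).
Proof.
move=> x0; apply: (le_trans (expRN_le_inv _)); first by rewrite mulr_gt0 ?cosh_gt0.
have ev := expR_gt0 v; have cv := cosh_gt0 v.
have -> : 2 / x * expR (- (1 * v)) = (x * (expR v / 2))^-1.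
  by rewrite mul1r expRN; field; rewrite !gt_eqF.
have a0 : 0 < x * cosh v by exact: mulr_gt0.
have b0 : 0 < x * (expR v / 2) by rewrite !mulr_gt0.
by rewrite lef_pV2// ler_wpM2l ?expR_half_le_cosh// ltW.
Qed.

Lemma is_derive_expcosh x v :
  is_derive v (1 : R) (fun v => expR (- (x * cosh v))) (- (x * sinh v) * expR (- (x * cosh v))).
Proof.
have dc : is_derive v (1 : R) (fun v => - (x * cosh v)) (- (x * sinh v)).
  have dc := is_derive_cosh v.
  by apply: is_derive_eq; rewrite /GRing.scale/=; ring.
have d : is_derive v (1 : R) (fun v => expR (- (x * cosh v)))
    (expR (- (x * cosh v)) * - (x * sinh v)).
  exact: (@is_derive1_comp R expR (fun v => - (x * cosh v)) v _ _ (is_derive_expR _) dc).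
by apply: is_derive_eq; rewrite mulrC.
Qed.

Lemma continuous_expcosh x : continuous (fun v : R => expR (- (x * cosh v))).
Proof. exact: continuous_derive (is_derive_expcosh x). Qed.

Lemma continuous_besselK_integrand tau x :
  continuous (fun v : R => expR (- (x * cosh v)) * cos (tau * v)).
Proof.
apply: continuous_mulr; first exact: continuous_expcosh.
exact: continuous_derive (is_derive_costau tau).
Qed.

Lemma itg_expcosh x : 0 < x -> itg (fun v => expR (- (x * cosh v))).
Proof.
move=> x0; apply: itg_le (itgZ (2 / x) (itg_expRN (ltr01 : 0 < 1 :> R))).
  by apply: continuous_measurable; exact: continuous_expcosh.
by move=> v v0; rewrite ger0_norm ?expR_ge0// expRcosh_le.
Qed.

Lemma itg_besselK tau x : 0 < x -> itg (fun v => expR (- (x * cosh v)) * cos (tau * v)).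
Proof.
move=> x0; apply: itg_le (itg_expcosh x0).
  by apply: continuous_measurable; exact: continuous_besselK_integrand.
move=> v v0; rewrite normrM ger0_norm ?expR_ge0// ler_piMr ?expR_ge0//.
exact: cos_max.
Qed.

Lemma besselK0E x : besselK 0 x = int0oo (fun v => expR (- (x * cosh v))).
Proof. by apply: int0oo_eq => v _; rewrite mul0r cos0 mulr1. Qed.

Lemma besselK0_ge0 x : 0 <= besselK 0 x.
Proof. by rewrite besselK0E; apply: Rintegral_ge0 => v _; exact: expR_ge0. Qed.

Lemma besselK_le tau x : 0 < x -> `|besselK tau x| <= besselK 0 x.
Proof.
move=> x0; rewrite besselK0E; apply: norm_int0oo_le; last 1 first.
- move=> v v0; rewrite normrM ger0_norm ?expR_ge0// ler_piMr ?expR_ge0//.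
  exact: cos_max.
- by apply: continuous_measurable; exact: continuous_besselK_integrand.
- exact: itg_expcosh.
Qed.

Lemma measurable_besselK :
  measurable_fun setT (fun z : R * R => besselK z.1 z.2).
Proof.
apply: (@measurable_Rintegral R _ _ _
  (fun (z : R * R) v => expR (- (z.2 * cosh v)) * cos (z.1 * v))).
  exact: measurable_Rpos.
apply: measurable_funM.
  apply: measurableT_comp => //; apply: measurableT_comp => //.
  apply: measurable_funM; first exact: measurableT_comp.
  by apply: measurableT_comp => //; exact: measurable_cosh.
apply: measurableT_comp; first exact: measurable_cos.
by apply: measurable_funM => //; exact: measurableT_comp.
Qed.

(** Integrating first in u gives i!/(1 + cosh v)^{i+1}: this is how the powers of
    1/(1 + cosh v) enter. *)
Lemma int_pow_besselK (i : nat) tau :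
  itg (fun u => expR (- u) * u ^+ i * besselK tau u) /\
  int0oo (fun u => expR (- u) * u ^+ i * besselK tau u) = i`!%:R * sechsq_moment tau i.+1.
Proof.
pose f u v : R := u ^+ i * expR (- ((1 + cosh v) * u)) * cos (tau * v).
have fE u v : f u v = expR (- u) * u ^+ i * (expR (- (u * cosh v)) * cos (tau * v)).
  rewrite /f (_ : - ((1 + cosh v) * u) = - u + - (u * cosh v)); last by ring.
  by rewrite expRD; ring.
have mf : measurable_fun setT (fun z : R * R => f z.1 z.2).
  apply: measurable_funM; first apply: measurable_funM => //.
  - exact: measurable_funX.
  - apply: measurableT_comp => //; apply: measurableT_comp => //.
    apply: measurable_funM => //; apply: measurable_funD => //.
    by apply: measurableT_comp => //; exact: measurable_cosh.
  - apply: measurableT_comp; first exact: measurable_cos.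
    exact: measurable_funM.
have fy v : 0 < v -> itg (f ^~ v) /\ int0oo (fun u => `|f u v|) <= i`!%:R * sechsq v ^+ i.+1.
  move=> _; have [i1 i2] := int_powexp i (cosh1_gt0 v).
  have i3 : itg (f ^~ v).
    by apply: itg_eq (itgZ (cos (tau * v)) i1) => u _; rewrite /f mulrC.
  split=> //; rewrite /sechsq exprVn -i2; apply: le_int0oo => //; first exact: itg_norm.
  move=> u u0; have p0 : 0 <= u ^+ i * expR (- ((1 + cosh v) * u)).
    by rewrite mulr_ge0 ?expR_ge0// exprn_ge0// ltW.
  by rewrite normrM (ger0_norm p0) ler_piMr ?cos_max.
have ih : itg (fun v => i`!%:R * sechsq v ^+ i.+1).
  apply: itgZ; apply: itg_eq (itg_sechsq_moment 0 i) => v _.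
  by rewrite mul0r cos0 mul1r.
have [i1 i2 e] := int0oo_swap mf fy ih.
have fu u : 0 < u -> int0oo (f u) = expR (- u) * u ^+ i * besselK tau u.
  move=> u0; rewrite /besselK -int0ooZ; last exact: itg_besselK.
  by apply: int0oo_eq => v _; rewrite fE.
split; first by apply: itg_eq i1.
rewrite -(int0oo_eq fu) e /sechsq_moment -int0ooZ; last exact: itg_sechsq_moment.
apply: int0oo_eq => v _; rewrite /f.
have [j1 j2] := int_powexp i (cosh1_gt0 v).
rewrite (int0oo_eq (g := fun u => cos (tau * v) * (u ^+ i * expR (- ((1 + cosh v) * u))))).
  by rewrite int0ooZ// j2 /sechsq exprVn; ring.
by move=> u _; rewrite mulrC.
Qed.

(** The functions e^{-y} p(y) form a space stable under A; on it, A becomes the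
    operator [conj_opA] on polynomials. *)
Definition expoly (p : {poly R}) (y : R) : R := expR (- y) * p.[y].

Definition conj_opA (p : {poly R}) : {poly R} :=
  'X ^+ 2 * p - 'X * (('X * (p^`() - p))^`() - 'X * (p^`() - p)).

(** The operator A conjugated by y e^{-y}: from the first iterate on, the polynomials
    are divisible by the variable, and p_k(u)/u is again a polynomial. *)
Definition conj_opA_divX (q : {poly R}) : {poly R} :=
  - ('X ^+ 2 * q^`()^`() + 3%:P * 'X * q^`() + q - 3%:P * 'X * q - 2%:P * 'X ^+ 2 * q^`()).

Lemma conj_opA_mulX q : conj_opA ('X * q) = 'X * conj_opA_divX q.
Proof.
rewrite /conj_opA /conj_opA_divX !poly.derivE.
ring.
Qed.

Lemma derive1_is (f df : R -> R) : (forall x, is_derive x (1 : R) f (df x)) ->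
  derive1 f = df.
Proof. by move=> d; apply/funext => x; rewrite derive1E; apply: derive_val. Qed.

Lemma derive1_expoly p : derive1 (expoly p) = expoly (p^`() - p).
Proof.
apply: derive1_is => x; rewrite /expoly.
have dp : is_derive x (1 : R) (fun y => p.[y]) (p^`()).[x] by exact: is_derive_poly.
apply: is_derive_eq; rewrite /GRing.scale/= hornerD hornerN; ring.
Qed.

Lemma opA_expoly p : opA (expoly p) = expoly (conj_opA p).
Proof.
apply/funext => x; rewrite /opA derive1_expoly.
rewrite (_ : (fun y => y * expoly (p^`() - p) y) = expoly ('X * (p^`() - p))); last first.
  by apply/funext => y; rewrite /expoly hornerM hornerX; ring.
rewrite derive1_expoly /expoly /conj_opA !(hornerD, hornerN, hornerM, hornerX, hornerXn).
ring.
Qed.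

(** Up to the sign (-1)^(n+1), this is the polynomial p_{n+1}(u)/u. *)
Definition klpoly (n : nat) : {poly R} := iter n conj_opA_divX 1.

Lemma iter_conj_opA n : iter n.+1 conj_opA 1 = 'X * klpoly n.
Proof.
elim: n => [|n IH]; last by rewrite iterS IH conj_opA_mulX.
by rewrite /= /conj_opA /klpoly /= derivC !poly.derivE; ring.
Qed.

Lemma yor_polyE n x : yor_poly n.+1 x = (-1) ^+ n.+1 * (x * (klpoly n).[x]).
Proof.
have h m : iter m opA (fun y : R => expR (- y)) = expoly (iter m conj_opA 1).
  elim: m => [|m IH]; last by rewrite !iterS IH opA_expoly.
  by apply/funext => y; rewrite /expoly /= hornerC mulr1.
rewrite /yor_poly h iter_conj_opA /expoly hornerM hornerX.
have e : expR x * expR (- x) = 1 by rewrite -expRD subrr expR0.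
by rewrite -mulrA; congr (_ * _); rewrite mulrA e mul1r.
Qed.

Lemma yor_gE n u : u != 0 ->
  yor_g n.+1 u = (-1) ^+ n.+1 * (expR (- u) * (klpoly n).[u]).
Proof. by move=> u0; rewrite /yor_g yor_polyE; field. Qed.

Definition klmoment tau (q : {poly R}) : R :=
  int0oo (fun u => expR (- u) * q.[u] * besselK tau u).

Lemma poly_linear_ind (P : {poly R} -> Prop) :
  P 0 -> (forall a i q, P q -> P (a *: 'X^i + q)) -> forall q, P q.
Proof.
move=> P0 PS q; rewrite -(coefK q) poly_def.
by elim/big_rec : _ => // i p _ Pp; exact: PS.
Qed.

Lemma itg_klmoment tau (q : {poly R}) :
  itg (fun u => expR (- u) * q.[u] * besselK tau u).
Proof.
elim/poly_linear_ind: q => [|a i q IH].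
  apply: itg_eq (itgZ 0 (int_pow_besselK 0 tau).1) => u _.
  by rewrite horner0 mulr0 !mul0r.
apply: itg_eq (itgD (itgZ a (int_pow_besselK i tau).1) IH) => u _.
by rewrite hornerD hornerZ hornerXn; ring.
Qed.

Lemma klmomentD tau a i q :
  klmoment tau (a *: 'X^i + q) = a * (i`!%:R * sechsq_moment tau i.+1) + klmoment tau q.
Proof.
have [i1 e1] := int_pow_besselK i tau.
rewrite -e1 -int0ooZ// /klmoment -int0ooD//; last 2 first.
- exact: itgZ.
- exact: itg_klmoment.
by apply: int0oo_eq => u _; rewrite hornerD hornerZ hornerXn; ring.
Qed.

Lemma klmoment0 tau : klmoment tau 0 = 0.
Proof.
rewrite -(mul0r (0`!%:R * sechsq_moment tau 1)) -(int_pow_besselK 0 tau).2.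
rewrite -int0ooZ; last exact: (int_pow_besselK 0 tau).1.
by apply: int0oo_eq => u _; rewrite horner0 mulr0 !mul0r.
Qed.

Lemma conj_opA_divX_monomial (a : R) (i : nat) (q : {poly R}) : conj_opA_divX (a *: 'X^i + q) =
  ((- a * i.+1%:R ^+ 2) *: 'X^i : {poly R}) + ((a * (2 * i%:R + 3)) *: 'X^(i.+1) + conj_opA_divX q).
Proof.
have dX : ('X^i : {poly R})^`() * 'X = i%:R *: 'X^i.
  rewrite derivXn; case: i => [|i]; first by rewrite mulr0n mul0r scale0r.
  by rewrite /= mulrnAl -exprSr scaler_nat.
have ddX : ('X^i : {poly R})^`()^`() * 'X ^+ 2 = (i%:R * (i%:R - 1)) *: 'X^i.
  have := congr1 (fun p => p^`() * 'X) dX.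
  rewrite derivM derivZ derivX mulr1 mulrDl => h.
  have -> : ('X^i : {poly R})^`()^`() * 'X ^+ 2 =
      i%:R *: (('X^i : {poly R})^`() * 'X) - ('X^i : {poly R})^`() * 'X.
    by rewrite scalerAl -h expr2 mulrA addrK.
  by rewrite dX scalerA -scalerBl mulrBr mulr1.
have XS : 'X^(i.+1) = 'X * 'X^i :> {poly R} by exact: exprS.
rewrite /conj_opA_divX !(derivD, derivZ) XS.
rewrite -!mul_polyC in dX ddX *.
rewrite !polyCM in ddX; rewrite !polyCM polyCN.
have -> : (i.+1%:R : R)%:P = (i%:R : R)%:P + 1 :> {poly R}.
  by rewrite -natr1 polyCD.
have -> : (2 * i%:R + 3 : R)%:P = 2%:P * (i%:R : R)%:P + 3%:P :> {poly R}.
  by rewrite polyCD polyCM.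
rewrite polyCB in ddX.
have c3 : 3%:P = 3 :> {poly R} by rewrite rmorph_nat.
have c2 : 2%:P = 2 :> {poly R} by rewrite rmorph_nat.
rewrite c3 c2; rewrite polyC1 in ddX.
move: dX ddX; move: ('X^i : {poly R})^`()^`() ('X^i : {poly R})^`() => D2 D1.
move: ('X^i : {poly R}) (i%:R : R)%:P (D1^`()) (q^`()^`()) (q^`()) => Xi n E2 q2 q1 dX ddX.
apply/eqP; rewrite -subr_eq0; apply/eqP.
transitivity (- a%:P * (E2 * 'X ^+ 2 - n * (n - 1) * Xi) +
   (2 * 'X - 3) * a%:P * (D1 * 'X - n * Xi)); last by rewrite dX ddX !subrr !mulr0 addr0.
by move: a%:P => b; ring.
Qed.

(** The polynomial form of the fact that A is symmetric with respect to du/u and has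
    K_{i tau} as eigenfunction for tau^2; on monomials it is exactly the
    recursion [sechsq_moment_rec]. *)
Lemma klmoment_conj_opA_divX tau q : klmoment tau (conj_opA_divX q) = tau ^+ 2 * klmoment tau q.
Proof.
elim/poly_linear_ind: q => [|a i q IH].
  by rewrite /conj_opA_divX !derivC !mulr0 subr0 !addr0 subr0 oppr0 klmoment0 mulr0.
rewrite conj_opA_divX_monomial !klmomentD IH.
have h := sechsq_moment_rec tau i.
have e : (2 * i%:R + 3) * ((i.+1)`!%:R * sechsq_moment tau i.+2) =
   i`!%:R * ((i.+1%:R ^+ 2 + tau ^+ 2) * sechsq_moment tau i.+1).
  by rewrite h factS natrM -natr1; ring.
by rewrite -(mulrA a) e; ring.
Qed.

Lemma klmoment_klpoly tau n :
  klmoment tau (klpoly n) = tau ^+ n.*2 * sechsq_moment tau 1.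
Proof.
elim: n => [|n IH].
  rewrite mul1r /klpoly /= -[1](_ : 1 *: 'X^0 + 0 = _).
    by rewrite klmomentD klmoment0 addr0 !mul1r ?fact0 ?mul1r.
  by rewrite scale1r expr0 addr0.
by rewrite /klpoly iterS klmoment_conj_opA_divX -/(klpoly n) IH doubleS !exprS; ring.
Qed.

End Macdonald.

(** * The spectral form of the Yor integral *)

Section Yor.
Context {R : realType}.
Notation mu := (@lebesgue_measure R).
Notation Rpos := (`]0%R, +oo[%classic : set R).
Notation itg f := (mu.-integrable Rpos (EFin \o f)).
Implicit Types x v tau : R.
Variable t : R.
Hypothesis t0 : 0 < t.

Definition gauss tau : R := expR (- (t * tau ^+ 2 / 2)).

Lemma gauss_ge0 tau : 0 <= gauss tau. Proof. exact: expR_ge0. Qed.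

Lemma is_derive_gauss tau : is_derive tau (1 : R) gauss (- (t * tau) * gauss tau).
Proof. by apply: is_derive_eq; rewrite /gauss /GRing.scale/=; field. Qed.

Lemma continuous_gauss : continuous gauss.
Proof. exact: continuous_derive is_derive_gauss. Qed.

Lemma is_derive_expc (c tau : R) :
  is_derive tau (1 : R) (fun x => expR (c * x)) (c * expR (c * tau)).
Proof. by apply: is_derive_eq; rewrite /GRing.scale/=; ring. Qed.

Lemma gauss_le (n : nat) (c tau : R) : 0 <= tau ->
  tau ^+ n * (gauss tau * expR (c * tau)) <=
  n`!%:R * expR ((c + 2) ^+ 2 / (2 * t)) * expR (- (1 * tau)).
Proof.
move=> tau0; have := pow_le_expR n ltr01 tau0; rewrite expr1n divr1 !mul1r => h.
apply: (@le_trans _ _ (n`!%:R * expR tau * (gauss tau * expR (c * tau)))).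
  by rewrite ler_wpM2r// mulr_ge0// expR_ge0.
rewrite /gauss -!mulrA ler_wpM2l// -!expRD ler_expR -subr_ge0.
(* the constant (c + 2)^2/(2t) completes the square *)
rewrite (_ : _ - _ = (t * tau - (c + 2)) ^+ 2 / (2 * t)).
  by rewrite divr_ge0 ?sqr_ge0// mulr_ge0// ltW.
by field; rewrite gt_eqF.
Qed.

Lemma continuous_gausspow n c : continuous (fun tau => tau ^+ n * (gauss tau * expR (c * tau))).
Proof.
apply: continuous_mulr; first exact: exprn_continuous.
apply: continuous_mulr; first exact: continuous_gauss.
exact: continuous_derive (is_derive_expc c).
Qed.

Lemma itg_gauss n c : itg (fun tau => tau ^+ n * (gauss tau * expR (c * tau))).
Proof.
apply: itg_le (itgZ (n`!%:R * expR ((c + 2) ^+ 2 / (2 * t))) (itg_expRN (ltr01 : 0 < 1 :> R))).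
  by apply: continuous_measurable; exact: continuous_gausspow.
move=> x x0; rewrite ger0_norm; first exact/gauss_le/ltW.
exact: mulr_ge0 (exprn_ge0 _ (ltW x0)) (mulr_ge0 (gauss_ge0 _) (expR_ge0 _)).
Qed.

Lemma measurable_gauss : measurable_fun setT gauss.
Proof. by apply: continuous_measurable; exact: continuous_gauss. Qed.

Lemma cvg_gauss0 : gauss tau @[tau --> +oo] --> (0 : R).
Proof.
apply: (@squeeze_cvgr _ _ _ _ (cst 0) (fun tau => 0`!%:R * expR ((0 + 2) ^+ 2 / (2 * t)) * expR (- (1 * tau)))).
- near=> x; have x0 : 0 <= x by near: x; apply: nbhs_pinfty_ge; exact: num_real.
  have := gauss_le 0 0 x0; rewrite mul0r expR0 expr0 mul1r mulr1 => ->.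
  by rewrite gauss_ge0.
- exact: cvg_cst.
- rewrite -[0 in X in _ --> X](mulr0 (0`!%:R * expR ((0 + 2) ^+ 2 / (2 * t)))).
  by apply: cvgM; [exact: cvg_cst|exact: expRN_cvg0].
Unshelve. all: end_near. Qed.

Lemma itg_gauss0 : itg gauss.
Proof.
by apply: itg_eq (itg_gauss 0 0) => x _; rewrite mul0r expR0 expr0 mul1r mulr1.
Qed.

Lemma itg_gauss1 : itg (fun x => `|x| * gauss x).
Proof.
apply: itg_eq (itg_gauss 1 0) => x x0.
by rewrite mul0r expR0 expr1 mulr1 gtr0_norm.
Qed.

Definition gaussF v : R := int0oo (fun tau => gauss tau * cos (tau * v)).

Lemma continuous_gausscos v : continuous (fun tau => gauss tau * cos (tau * v)).
Proof.
apply: continuous_mulr; first exact: continuous_gauss.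
rewrite (_ : (fun x => cos (x * v)) = (fun x => cos (v * x))).
  exact: continuous_derive (is_derive_costau v).
by apply/funext => x; rewrite mulrC.
Qed.

Lemma continuous_gausssin v : continuous (fun tau => gauss tau * sin (tau * v)).
Proof.
apply: continuous_mulr; first exact: continuous_gauss.
rewrite (_ : (fun x => sin (x * v)) = (fun x => sin (v * x))).
  exact: continuous_derive (is_derive_sintau v).
by apply/funext => x; rewrite mulrC.
Qed.

Lemma itg_gausscos v : itg (fun tau => gauss tau * cos (tau * v)).
Proof.
apply: itg_le itg_gauss0.
  by apply: continuous_measurable; exact: continuous_gausscos.
by move=> x _; rewrite normrM ger0_norm ?gauss_ge0// ler_piMr ?gauss_ge0// cos_max.
Qed.

Lemma itg_gausssin v : itg (fun tau => tau * (gauss tau * sin (tau * v))).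
Proof.
apply: itg_le itg_gauss1.
  apply: continuous_measurable; apply: continuous_mulr; last exact: continuous_gausssin.
  by move=> x; exact: cvg_id.
move=> x _; rewrite !normrM ler_wpM2l// ger0_norm ?gauss_ge0//.
by rewrite ler_piMr ?gauss_ge0// sin_max.
Qed.

(** Together with differentiation under the integral sign, this gives the
    differential equation F' = -(v/t) F for the cosine transform of the Gaussian. *)
Lemma gaussF_ibp v : t * int0oo (fun tau => tau * (gauss tau * sin (tau * v))) = v * gaussF v.
Proof.
pose f tau : R := v * (gauss tau * cos (tau * v)) + - t * (tau * (gauss tau * sin (tau * v))).
have d x : is_derive x (1 : R) (fun tau => gauss tau * sin (tau * v)) (f x).
  have dg := is_derive_gauss x.
  by apply: is_derive_eq; rewrite /f /GRing.scale/=; ring.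
have cf : continuous f.
  move=> x; apply: cvgD; (apply: cvgM; first exact: cvg_cst).
    exact: continuous_gausscos.
  apply: cvgM; [exact: cvg_id|exact: continuous_gausssin].
have i1 := itgZ v (itg_gausscos v); have i2 := itgZ (- t) (itg_gausssin v).
have := int0oo_FTC d cf (itgD i1 i2) (l := 0).
rewrite int0ooD// int0ooZ; last exact: itg_gausscos.
rewrite int0ooZ; last exact: itg_gausssin.
rewrite mul0r sin0 mulr0 subrr mulNr => H.
apply/esym/eqP; rewrite -subr_eq0; apply/eqP/H.
apply: norm_cvg0; apply: (@squeeze_cvgr _ _ _ _ (cst 0) gauss).
- apply: nearW => x; rewrite normr_ge0/= normrM ger0_norm ?gauss_ge0//.
  by rewrite ler_piMr ?gauss_ge0// sin_max.
- exact: cvg_cst.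
- exact: cvg_gauss0.
Qed.

Lemma is_derive_gaussF v : is_derive v (1 : R) gaussF (- (v / t) * gaussF v).
Proof.
pose f (x y : R) : R := gauss y * cos (y * x).
have pf x y : is_derive x (1 : R) (f ^~ y) (- (y * (gauss y * sin (y * x)))).
  by apply: is_derive_eq; rewrite /GRing.scale/=; ring.
have pE x y : partial1of2 f x y = - (y * (gauss y * sin (y * x))).
  by rewrite partial1of2E; apply: derive_val.
have Iv : `]v - 1, v + 1[%classic v by rewrite /= in_itv/=; lra.
have If x : `]v - 1, v + 1[%classic x -> itg (f x) by move=> _; exact: itg_gausscos.
have Df x y : `]v - 1, v + 1[%classic x -> Rpos y -> derivable (f ^~ y) x 1.
  by move=> _ _; apply: ex_derive.
have G0 y : 0 <= `|y| * gauss y by rewrite mulr_ge0 ?gauss_ge0.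
have Gb x y : `]v - 1, v + 1[%classic x -> Rpos y -> `|partial1of2 f x y| <= `|y| * gauss y.
  move=> _ _; rewrite pE normrN !normrM ler_wpM2l// ger0_norm ?gauss_ge0//.
  by rewrite ler_piMr ?gauss_ge0// sin_max.
have D := @derivable_under_integral R _ _ mu f Rpos measurable_Rpos v (v - 1) (v + 1) Iv If Df _ G0 itg_gauss1 Gb.
have V := @differentiation_under_integral R _ _ mu f Rpos measurable_Rpos v (v - 1) (v + 1) Iv If Df _ G0 itg_gauss1 Gb.
apply: DeriveDef; first exact: D.
rewrite -derive1E [LHS]V.
rewrite (_ : \int[mu]_(y in Rpos) partial1of2 f v y =
  int0oo (fun y => -1 * (y * (gauss y * sin (y * v))))); last first.
  by apply: eq_Rintegral => y _; rewrite pE mulN1r.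
rewrite int0ooZ; last exact: itg_gausssin.
have tn : t != 0 by rewrite gt_eqF.
apply: (mulfI tn); transitivity (- (v * gaussF v)); last by field.
by rewrite -gaussF_ibp; ring.
Qed.

Lemma gaussF0 : gaussF 0 = Num.sqrt (2 * pi / t) / 2.
Proof.
pose s := (Num.sqrt t)^-1.
have st : 0 < Num.sqrt t by rewrite sqrtr_gt0.
have s0 : s != 0 by rewrite invr_neq0// gt_eqF.
have s2 : s ^+ 2 = t^-1 by rewrite exprVn sqr_sqrtr// ltW.
have := integral_normal_pdf 0 s.
have -> : (\int[mu]_x (normal_pdf 0 s x)%:E = \int[mu]_x (normal_peak s * gauss x)%:E)%E.
  apply: eq_integral => x _.
  rewrite normal_pdfE// /normal_fun s2 subr0; congr (_ * expR _)%:E.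
  by field; rewrite gt_eqF.
have p0 : 0 < normal_peak s by exact: normal_peak_gt0.
rewrite (@ge0_integral_fold R (fun x => normal_peak s * gauss x)); last 2 first.
- by apply: continuous_mulr; [move=> x; exact: cvg_cst|exact: continuous_gauss].
- by move=> x; rewrite mulr_ge0 ?gauss_ge0// ltW.
move=> /(congr1 fine); rewrite -/(Rintegral _ _ _) -/(int0oo _) /=.
rewrite (int0oo_eq (g := fun x => 2 * normal_peak s * (gauss x * cos (x * 0)))); last first.
  by move=> x _; rewrite mulr0 cos0 /gauss sqrrN; ring.
rewrite int0ooZ; last exact: itg_gausscos.
rewrite -/(gaussF 0) => h.
have -> : gaussF 0 = (2 * normal_peak s)^-1.
  apply: (mulfI (_ : 2 * normal_peak s != 0)); first by rewrite mulf_neq0// gt_eqF.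
  by rewrite h divff// mulf_neq0// gt_eqF.
rewrite /normal_peak invfM invrK s2 mulrC; congr (Num.sqrt _ / _).
by rewrite -mulr_natl; ring.
Qed.

Lemma gaussFE v : gaussF v = Num.sqrt (2 * pi / t) / 2 * expR (- (v ^+ 2 / (2 * t))).
Proof.
have d x : is_derive x (1 : R) (fun x => gaussF x * expR (x ^+ 2 / (2 * t))) 0.
  have dg := is_derive_gaussF x.
  apply: is_derive_eq; rewrite /GRing.scale/=; field.
  by rewrite gt_eqF.
have := is_derive_0_is_cst v 0 d.
rewrite expr0n/= mul0r expR0 mulr1 gaussF0 => <-.
by rewrite -mulrA -expRD subrr expR0 mulr1.
Qed.

(** By parity the integral is half of the integral of
    e^{-t tau^2/2 + pi tau} sin(tau v) over the line; completing the square is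
    the translation by pi/t. *)
Lemma gauss_sinh_sin v :
  int0oo (fun tau => gauss tau * sinh (pi * tau) * sin (tau * v)) =
  expR (pi ^+ 2 / (2 * t)) * sin (pi * v / t) * gaussF v.
Proof.
pose g x : R := gauss x * expR (pi * x) * sin (x * v).
have cg : continuous g.
  rewrite (_ : g = (fun x => expR (pi * x) * (gauss x * sin (x * v)))); last first.
    by apply/funext => x; rewrite /g; ring.
  apply: continuous_mulr; last exact: continuous_gausssin.
  exact: continuous_derive (is_derive_expc pi).
have mg : measurable_fun setT g by exact: continuous_measurable.
have ig c : itg (fun x => gauss x * expR (c * x) * sin (x * v)).
  have -> : (fun x => gauss x * expR (c * x) * sin (x * v)) =
      (fun x => expR (c * x) * (gauss x * sin (x * v))).
    by apply/funext => x; ring.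
  apply: itg_le (itg_gauss 0 c).
    apply: continuous_measurable; apply: continuous_mulr; last exact: continuous_gausssin.
    exact: continuous_derive (is_derive_expc c).
  move=> x _; rewrite expr0 mul1r mulrA (mulrC (expR _)) normrM ger0_norm.
    by apply: ler_piMr (sin_max _); exact: mulr_ge0 (gauss_ge0 _) (expR_ge0 _).
  exact: mulr_ge0 (gauss_ge0 _) (expR_ge0 _).
have igT : mu.-integrable setT (EFin \o g).
  apply/(integrable_fold cg); split; first exact: ig.
  apply: itg_eq (itgZ (-1) (ig (- pi))) => x _.
  by rewrite /g /gauss sqrrN (mulrN pi) (mulNr x v) (mulNr pi x) sinN; ring.
have e1 := Rintegral_fold cg igT.
have cgs : continuous (fun x => g (x + pi / t)).
  move=> x; apply: (@continuous_comp _ _ _ (fun x => x + pi / t) g); last exact: cg.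
  by apply: cvgD; [exact: cvg_id|exact: cvg_cst].
have e2 := Rintegral_fold cgs (integrable_shift (pi / t) cg igT).
rewrite (Rintegral_shift _ cg igT) e1 in e2.
have l1 : int0oo (fun x => g x + g (- x)) =
    2 * int0oo (fun tau => gauss tau * sinh (pi * tau) * sin (tau * v)).
  rewrite -int0ooZ.
    apply: int0oo_eq => x _; by rewrite /g /sinh /gauss sqrrN (mulrN pi) (mulNr x v) sinN; field.
  apply: itg_eq (itgD (itgZ (1/2) (ig pi)) (itgZ (- (1/2)) (ig (- pi)))) => x _.
  by rewrite /sinh (mulNr pi); field.
have l2 : int0oo (fun x => g (x + pi / t) + g (- x + pi / t)) =
    2 * (expR (pi ^+ 2 / (2 * t)) * sin (pi * v / t) * gaussF v).
  rewrite /gaussF -int0ooZ; last exact: itg_gausscos.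
  rewrite -int0ooZ; last exact/itgZ/itg_gausscos.
  apply: int0oo_eq => x _; rewrite /g /gauss -!expRD.
  have -> : - (t * (x + pi / t) ^+ 2 / 2) + pi * (x + pi / t) =
      pi ^+ 2 / (2 * t) + - (t * x ^+ 2 / 2).
    by field; rewrite gt_eqF.
  have -> : - (t * (- x + pi / t) ^+ 2 / 2) + pi * (- x + pi / t) =
      pi ^+ 2 / (2 * t) + - (t * x ^+ 2 / 2).
    by field; rewrite gt_eqF.
  have -> : (x + pi / t) * v = x * v + pi * v / t by ring.
  have -> : (- x + pi / t) * v = - (x * v) + pi * v / t by ring.
  by rewrite expRD !sinD sinN cosN; ring.
have two : (2 : R) != 0 by rewrite pnatr_eq0.
by apply: (mulfI two); rewrite -l1 -l2 e2.
Qed.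
Lemma measurable_besselK1 y : measurable_fun setT (fun tau : R => besselK tau y).
Proof.
exact: (measurableT_comp (f := fun z : R * R => besselK z.1 z.2) (g := fun tau => (tau, y))
  measurable_besselK (measurable_fun_pair (@measurable_id _ _ _) (@measurable_cst _ _ _ _ _ y))).
Qed.

Definition yor_density tau : R := gauss tau * tau * sinh (pi * tau).

Lemma yor_density_ge0 tau : 0 < tau -> 0 <= yor_density tau.
Proof.
move=> tau0; rewrite /yor_density mulr_ge0 ?sinh_ge0 ?mulr_ge0 ?gauss_ge0 ?pi_ge0//; exact: ltW.
Qed.

Lemma measurable_yor_density : measurable_fun setT yor_density.
Proof.
apply: measurable_funM; first by apply: measurable_funM => //; exact: measurable_gauss.
by apply: measurableT_comp; [exact: measurable_sinh|].
Qed.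

Lemma itg_yor_density : itg yor_density.
Proof.
apply: itg_eq (itgD (itgZ (1/2) (itg_gauss 1 pi)) (itgZ (- (1/2)) (itg_gauss 1 (- pi)))) => x _.
by rewrite /yor_density /sinh (mulNr pi) expr1; field.
Qed.

Lemma itg_gausssinh : itg (fun tau => gauss tau * sinh (pi * tau)).
Proof.
apply: itg_eq (itgD (itgZ (1/2) (itg_gauss 0 pi)) (itgZ (- (1/2)) (itg_gauss 0 (- pi)))) => x _.
by rewrite /sinh (mulNr pi) expr0; field.
Qed.

Lemma sinhexp_ge0 y v : 0 < y -> 0 <= v -> 0 <= y * sinh v * expR (- (y * cosh v)).
Proof.
move=> y0 v0; apply: mulr_ge0; last exact: expR_ge0.
by apply: mulr_ge0; [exact: ltW|exact: sinh_ge0].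
Qed.

Lemma itg_sinhexp y : 0 < y -> itg (fun v => y * sinh v * expR (- (y * cosh v))).
Proof.
move=> y0.
have d v : is_derive v (1 : R) (fun v => - expR (- (y * cosh v))) (y * sinh v * expR (- (y * cosh v))).
  have de := is_derive_expcosh y v.
  by apply: is_derive_eq; ring.
have [] // := ge0_int0oo_FTC d _ _ (_ : _ --> (0 : R)).
- apply: continuous_mulr; last exact: continuous_expcosh.
  by move=> x; apply: cvgM; [exact: cvg_cst|exact: continuous_sinh].
- by move=> x x0; exact: sinhexp_ge0.
- rewrite -[0 in X in _ --> X]oppr0; apply: cvgN.
  apply: (@squeeze_cvgr _ _ _ _ (cst 0) (fun v => 2 / y * expR (- (1 * v)))).
  + by apply: nearW => v; rewrite expR_ge0 expRcosh_le.
  + exact: cvg_cst.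
  + rewrite -[0 in X in _ --> X](mulr0 (2 / y)).
    by apply: cvgM; [exact: cvg_cst|exact: expRN_cvg0].
Qed.

(** The factor tau of the spectral density is absorbed by an integration by parts,
    which produces the factor sinh v of the Yor integral. *)
Lemma besselK_ibp tau y : 0 < y ->
  tau * besselK tau y = int0oo (fun v => y * sinh v * expR (- (y * cosh v)) * sin (tau * v)).
Proof.
move=> y0.
pose f v : R := tau * (expR (- (y * cosh v)) * cos (tau * v)) +
  -1 * (y * sinh v * expR (- (y * cosh v)) * sin (tau * v)).
have d v : is_derive v (1 : R) (fun v => expR (- (y * cosh v)) * sin (tau * v)) (f v).
  have de := is_derive_expcosh y v; have ds := is_derive_sintau tau v.
  by apply: is_derive_eq; rewrite /f /GRing.scale/=; ring.
have c2 : continuous (fun v : R => y * sinh v * expR (- (y * cosh v)) * sin (tau * v)).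
  apply: continuous_mulr; last exact: continuous_derive (is_derive_sintau tau).
  apply: continuous_mulr; last exact: continuous_expcosh.
  by move=> x; apply: cvgM; [exact: cvg_cst|exact: continuous_sinh].
have cf : continuous f.
  move=> x; apply: cvgD; (apply: cvgM; first exact: cvg_cst).
    exact: continuous_besselK_integrand.
  exact: c2.
have i1 := itg_besselK tau y0.
have i2 : itg (fun v => y * sinh v * expR (- (y * cosh v)) * sin (tau * v)).
  apply: itg_le (itg_sinhexp y0); first exact: continuous_measurable.
  move=> v v0; have k0 := sinhexp_ge0 y0 (ltW v0).
  by rewrite normrM (ger0_norm k0) ler_piMr ?sin_max.
have := int0oo_FTC d cf (itgD (itgZ tau i1) (itgZ (-1) i2)) (l := 0).
rewrite int0ooD; [|exact: itgZ|exact: itgZ].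
rewrite !int0ooZ// mulr0 sin0 mulr0 subrr mulN1r => H.
apply/eqP; rewrite -subr_eq0; apply/eqP/H.
apply: norm_cvg0; apply: (@squeeze_cvgr _ _ _ _ (cst 0) (fun v => 2 / y * expR (- (1 * v)))).
- apply: nearW => x; rewrite normr_ge0/= normrM ger0_norm ?expR_ge0//.
  by apply: le_trans (expRcosh_le x y0); rewrite ler_piMr ?expR_ge0// sin_max.
- exact: cvg_cst.
- rewrite -[0 in X in _ --> X](mulr0 (2 / y)).
  by apply: cvgM; [exact: cvg_cst|exact: expRN_cvg0].
Qed.

Lemma yor_const : Num.sqrt (2 * pi / t) / 2 / pi ^+ 2 = (Num.sqrt (2 * pi ^+ 3 * t))^-1.
Proof.
have p0 := pi_gt0 R.
have a0 : 0 < 2 * pi / t by rewrite divr_gt0// mulr_gt0.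
have b0 : 0 < 2 * pi ^+ 3 * t by rewrite !mulr_gt0// exprn_gt0.
have b1 : Num.sqrt (2 * pi ^+ 3 * t) != 0 by rewrite gt_eqF// sqrtr_gt0.
apply: (mulIf b1); rewrite mulVf// mulrAC (mulrAC _ 2^-1) -sqrtrM ?ltW//.
rewrite (_ : 2 * pi / t * (2 * pi ^+ 3 * t) = (2 * pi ^+ 2) ^+ 2).
  rewrite sqrtr_sqr ger0_norm.
    by rewrite -mulrA -invfM divff// mulf_neq0// expf_neq0// gt_eqF.
  by rewrite mulr_ge0// sqr_ge0.
by field; rewrite gt_eqF.
Qed.

(** Exchanging the integrals leaves in tau the sine transform [gauss_sinh_sin] of the
    Gaussian times sinh (pi tau), which is the remaining part of the Yor integrand. *)
Lemma yor_spectral y : 0 < y ->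
  yor t y = 1 / (y * pi ^+ 2) * int0oo (fun tau => yor_density tau * besselK tau y).
Proof.
move=> y0.
pose k v : R := y * sinh v * expR (- (y * cosh v)).
pose f tau v : R := gauss tau * sinh (pi * tau) * (k v * sin (tau * v)).
have k0 v : 0 < v -> 0 <= k v by move=> v0; exact/sinhexp_ge0/ltW.
have mk : measurable_fun setT k.
  apply: measurable_funM; first by apply: measurable_funM => //; exact: measurable_sinh.
  by apply: continuous_measurable; exact: continuous_expcosh.
have mgs : measurable_fun setT (fun tau : R => gauss tau * sinh (pi * tau)).
  apply: measurable_funM; first exact: measurable_gauss.
  by apply: measurableT_comp; [exact: measurable_sinh|].
have mf : measurable_fun setT (fun z : R * R => f z.1 z.2).
  apply: measurable_funM; first exact: (measurableT_comp mgs).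
  apply: measurable_funM; first exact: (measurableT_comp mk).
  by apply: measurableT_comp; [exact: measurable_sin|exact: measurable_funM].
pose C := int0oo (fun tau => gauss tau * sinh (pi * tau)).
have gs0 tau : 0 < tau -> 0 <= gauss tau * sinh (pi * tau).
  by move=> h; rewrite mulr_ge0 ?gauss_ge0 ?sinh_ge0// mulr_ge0 ?pi_ge0// ltW.
have fle tau v : 0 < tau -> 0 < v -> `|f tau v| <= k v * (gauss tau * sinh (pi * tau)).
  move=> h1 h2; rewrite /f normrM (ger0_norm (gs0 _ h1)) mulrC ler_wpM2r ?gs0//.
  by rewrite normrM ger0_norm ?k0// ler_piMr ?k0// sin_max.
have fy v : 0 < v -> itg (f ^~ v) /\ int0oo (fun tau => `|f tau v|) <= C * k v.
  move=> v0.
  have i1 : itg (f ^~ v).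
    apply: itg_le (itgZ (k v) itg_gausssinh).
      apply: measurable_funM => //; apply: measurable_funM => //.
      by apply: measurableT_comp; [exact: measurable_sin|exact: measurable_funM].
    by move=> tau h; exact: fle.
  split=> //; rewrite mulrC /C -int0ooZ; last exact: itg_gausssinh.
  apply: le_int0oo; [exact: itg_norm|exact/itgZ/itg_gausssinh|].
  by move=> tau h; exact: fle.
have [i1 i2 e] := int0oo_swap mf fy (itgZ C (itg_sinhexp y0)).
have s1 : int0oo (fun tau => yor_density tau * besselK tau y) = int0oo (fun tau => int0oo (f tau)).
  apply: int0oo_eq => tau _; rewrite /yor_density.
  have -> : gauss tau * tau * sinh (pi * tau) * besselK tau y =
    gauss tau * sinh (pi * tau) * (tau * besselK tau y) by ring.
  rewrite besselK_ibp// -int0ooZ//.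
  apply: itg_le (itg_sinhexp y0).
    apply: measurable_funM => //.
    by apply: measurableT_comp; [exact: measurable_sin|exact: measurable_funM].
  by move=> v v0; rewrite normrM -/(k v) ger0_norm ?k0// ler_piMr ?k0// sin_max.
rewrite s1 e /yor.
have s2 : int0oo (fun v => int0oo (f ^~ v)) =
  y * (expR (pi ^+ 2 / (2 * t)) * (Num.sqrt (2 * pi / t) / 2)) *
  int0oo (fun v => expR (- (v ^+ 2 / (2 * t))) * expR (- (y * cosh v)) * sinh v * sin (pi * v / t)).
  rewrite -int0ooZ; last first.
    apply: itg_le (itgZ y^-1 (itg_sinhexp y0)).
      apply: measurable_funM; last first.
        by apply: measurableT_comp; [exact: measurable_sin|exact: measurable_funM].
      apply: measurable_funM; last exact: measurable_sinh.
      apply: measurable_funM; last by apply: continuous_measurable; exact: continuous_expcosh.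
      apply: measurableT_comp => //; apply: measurableT_comp => //.
      by apply: measurable_funM => //; exact: measurable_funX.
    move=> v v0; rewrite -(mulrA y) mulKf ?gt_eqF//.
    have hs : 0 <= sinh v by exact/sinh_ge0/ltW.
    move: (sinh v) hs => s hs.
    rewrite [leRHS]mulrC -[leRHS]mulr1 -[X in _ <= X * _ * _]mul1r.
    rewrite !normrM !(ger0_norm (expR_ge0 _)) (ger0_norm hs).
    apply: ler_pM => //; last exact: sin_max.
      by rewrite !mulr_ge0 ?expR_ge0.
    apply: ler_wpM2r => //; apply: ler_wpM2r; first exact: expR_ge0.
    by rewrite expR_le1 oppr_le0 divr_ge0 ?sqr_ge0// mulr_ge0// ltW.
  apply: int0oo_eq => v v0.
  rewrite (int0oo_eq (g := fun tau => k v * (gauss tau * sinh (pi * tau) * sin (tau * v)))); last first.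
    by move=> tau _; rewrite /f; ring.
  rewrite int0ooZ.
    by rewrite gauss_sinh_sin gaussFE /k; ring.
  apply: itg_le itg_gausssinh.
    apply: measurable_funM => //.
    by apply: measurableT_comp; [exact: measurable_sin|exact: measurable_funM].
  by move=> tau h; rewrite normrM ger0_norm ?gs0// ler_piMr ?gs0// sin_max.
have yn : y != 0 by rewrite gt_eqF.
have pn : pi != 0 :> R by rewrite gt_eqF// pi_gt0.
have alg (p q a I : R) : p != 0 ->
    a * (q / 2 / p ^+ 2) * I = 1 / (y * p ^+ 2) * (y * (a * (q / 2)) * I).
  by move=> p0; field; rewrite p0 yn.
by rewrite s2 -yor_const; exact: alg.
Qed.

Lemma yor_le y : 0 < y -> `|yor t y| <= (int0oo yor_density / pi ^+ 2) * (besselK 0 y / y).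
Proof.
move=> y0; rewrite yor_spectral// normrM ger0_norm; last first.
  by rewrite divr_ge0// mulr_ge0 ?sqr_ge0// ltW.
have : `|int0oo (fun tau => yor_density tau * besselK tau y)| <= int0oo (fun tau => besselK 0 y * yor_density tau).
  apply: norm_int0oo_le.
  - apply: measurable_funM; first exact: measurable_yor_density.
    exact: measurable_besselK1.
  - exact/itgZ/itg_yor_density.
  - move=> tau h; rewrite normrM (ger0_norm (yor_density_ge0 h)) mulrC.
    by rewrite ler_wpM2r ?yor_density_ge0// besselK_le.
rewrite int0ooZ; last exact: itg_yor_density.
move=> h; rewrite (_ : _ * (besselK 0 y / y) = 1 / (y * pi ^+ 2) * (besselK 0 y * int0oo yor_density)).
  rewrite ler_wpM2l// divr_ge0// mulr_ge0 ?sqr_ge0// ltW//.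
have yn : y != 0 by rewrite gt_eqF.
have pn : pi != 0 :> R by rewrite gt_eqF// pi_gt0.
have alg (p I K : R) : p != 0 -> I / p ^+ 2 * (K / y) = 1 / (y * p ^+ 2) * (K * I).
  by move=> p0; field; rewrite p0 yn.
exact: alg.
Qed.

End Yor.

(** * Macdonald's product formula *)

Section ProductFormula.
Context {R : realType}.
Notation mu := (@lebesgue_measure R).
Notation Rpos := (`]0%R, +oo[%classic : set R).
Notation itg f := (mu.-integrable Rpos (EFin \o f)).
Notation itgT f := (mu.-integrable setT (EFin \o f)).
Implicit Types x u s a b y tau : R.

Lemma int_expcosh_shift tau u a : 0 < u ->
  itgT (fun s => expR (- (u * cosh (s - a))) * cos (tau * s)) /\
  \int[mu]_s (expR (- (u * cosh (s - a))) * cos (tau * s)) = 2 * besselK tau u * cos (tau * a).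
Proof.
move=> u0.
have cg : continuous (fun b => expR (- (u * cosh b)) * cos (tau * (b + a))).
  apply: continuous_mulr; first exact: continuous_expcosh.
  have d b : is_derive b (1 : R) (fun b => cos (tau * (b + a))) (- tau * sin (tau * (b + a))).
    by apply: is_derive_eq; rewrite /GRing.scale/=; ring.
  exact: continuous_derive d.
have ic c : itg (fun b => expR (- (u * cosh b)) * cos (tau * (c * b + a))).
  apply: itg_le (itg_expcosh u0).
    apply: continuous_measurable; apply: continuous_mulr; first exact: continuous_expcosh.
    have d b : is_derive b (1 : R) (fun b => cos (tau * (c * b + a))) (- (tau * c) * sin (tau * (c * b + a))).
      by apply: is_derive_eq; rewrite /GRing.scale/=; ring.
    exact: continuous_derive d.
  by move=> b _; rewrite normrM ger0_norm ?expR_ge0// ler_piMr ?expR_ge0// cos_max.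
have ig : itgT (fun b => expR (- (u * cosh b)) * cos (tau * (b + a))).
  apply/(integrable_fold cg); split.
    by apply: itg_eq (ic 1) => b _; rewrite mul1r.
  by apply: itg_eq (ic (-1)) => b _; rewrite coshN mulN1r.
have sE : (fun s => expR (- (u * cosh (s - a))) * cos (tau * s)) =
    (fun s => (fun b => expR (- (u * cosh b)) * cos (tau * (b + a))) (s + - a)).
  by apply/funext => s /=; rewrite subrK.
rewrite sE; split; first exact: (integrable_shift (- a) cg ig).
rewrite (Rintegral_shift (- a) cg ig) (Rintegral_fold cg ig).
rewrite (int0oo_eq (g := fun b => 2 * cos (tau * a) * (expR (- (u * cosh b)) * cos (tau * b)))).
  by rewrite int0ooZ; [rewrite /besselK; ring|exact: itg_besselK].
move=> b _; rewrite coshN.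
have -> : tau * (b + a) = tau * b + tau * a by ring.
have -> : tau * (- b + a) = - (tau * b) + tau * a by ring.
by rewrite !cosD sinN cosN; ring.
Qed.

Lemma int_expcosh tau x : 0 < x ->
  itgT (fun a => expR (- (x * cosh a)) * cos (tau * a)) /\
  \int[mu]_a (expR (- (x * cosh a)) * cos (tau * a)) = 2 * besselK tau x.
Proof.
move=> x0; have [i e] := int_expcosh_shift tau 0 x0.
have E : (fun s => expR (- (x * cosh (s - 0))) * cos (tau * s)) =
  (fun a => expR (- (x * cosh a)) * cos (tau * a)) by apply/funext => s; rewrite subr0.
by rewrite E in i e; rewrite e mulr0 cos0 mulr1.
Qed.

(** The integrand of K_{i tau}(x) K_{i tau}(u), each factor extended to the whole line,
    in the variables a and s = a + b, after which the oscillating factor depends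
    on s only. *)
Definition expcosh2 x u s a : R := expR (- (x * cosh a)) * expR (- (u * cosh (s - a))).

Definition convcosh x u s : R := \int[mu]_a expcosh2 x u s a.

Lemma measurable_expcosh d (T : measurableType d) x (f : T -> R) :
  measurable_fun setT f -> measurable_fun setT (fun z => expR (- (x * cosh (f z)))).
Proof.
move=> mf; apply: (measurableT_comp (f := fun v : R => expR (- (x * cosh v)))) mf.
by apply: continuous_measurable; exact: continuous_expcosh.
Qed.

Lemma measurable_expcosh2 x u :
  measurable_fun setT (fun z : R * R => expcosh2 x u z.1 z.2).
Proof.
apply: measurable_funM; first exact: measurable_expcosh.
by apply: measurable_expcosh; exact: measurable_funB.
Qed.

Lemma measurable_coscomp d (T : measurableType d) tau (f : T -> R) :
  measurable_fun setT f -> measurable_fun setT (fun z => cos (tau * f z)).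
Proof.
move=> mf; apply: (measurableT_comp measurable_cos).
by apply: measurable_funM => //; exact: measurable_cst.
Qed.

Lemma itg_expcosh2 x u s : 0 < x -> 0 < u -> itgT (expcosh2 x u s).
Proof.
move=> x0 u0; have [iK _] := int_expcosh 0 x0.
apply: (@le_integrable _ _ R mu setT _ (EFin \o expcosh2 x u s) _ _ _ iK) => //.
  apply/measurable_EFinP; apply: measurable_funM; first exact: measurable_expcosh.
  by apply: measurable_expcosh; exact: measurable_funB.
move=> a _; rewrite lee_fin mul0r cos0 mulr1 /expcosh2 normrM !(ger0_norm (expR_ge0 _)).
by rewrite ler_piMr ?expR_ge0// expR_le1 oppr_le0 mulr_ge0 ?ltW// cosh_gt0.
Qed.

(** Integrating in s first, the translation by a splits cos (tau s), and only the
    even part cos (tau a) cos (tau b) survives. *)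
Lemma convcosh_swap tau x u : 0 < x -> 0 < u ->
  itgT (fun s => convcosh x u s * cos (tau * s)) /\
  \int[mu]_s (convcosh x u s * cos (tau * s)) = 4 * (besselK tau x * besselK tau u).
Proof.
move=> x0 u0.
have mf : measurable_fun setT (fun z : R * R => expcosh2 x u z.1 z.2 * cos (tau * z.1)).
  by apply: measurable_funM; [exact: measurable_expcosh2|exact: measurable_coscomp].
have [iK _] := int_expcosh 0 x0.
have fy a : setT a -> itgT (fun s => expcosh2 x u s a * cos (tau * s)) /\
    \int[mu]_s `|expcosh2 x u s a * cos (tau * s)| <=
    2 * besselK 0 u * (expR (- (x * cosh a)) * cos (0 * a)).
  move=> _.
  have [i1 _] := int_expcosh_shift tau a u0.
  have [i2 e2] := int_expcosh_shift 0 a u0.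
  have i3 : itgT (fun s => expcosh2 x u s a * cos (tau * s)).
    have := integrableZl measurableT (expR (- (x * cosh a))) i1.
    apply: eq_integrable => // s _ /=; rewrite -EFinM; congr EFin.
    by rewrite /expcosh2 mulrA.
  split; first exact: i3.
  have i4 : itgT (fun s => expR (- (x * cosh a)) * (expR (- (u * cosh (s - a))) * cos (0 * s))).
    exact: (integrableZl measurableT (expR (- (x * cosh a))) i2).
  have -> : 2 * besselK 0 u * (expR (- (x * cosh a)) * cos (0 * a)) =
     \int[mu]_s (expR (- (x * cosh a)) * (expR (- (u * cosh (s - a))) * cos (0 * s))).
    by rewrite RintegralZl// e2; ring.
  rewrite /Rintegral fine_le//.
  - by have j3 := integrable_norm i3; apply: integrable_fin_num j3.
  - by apply: integrable_fin_num i4.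
  - apply: le_integral => //; first exact: integrable_norm i3.
    move=> s _; rewrite lee_fin mul0r cos0 mulr1 normrM /expcosh2.
    have e0 : 0 <= expR (- (x * cosh a)) * expR (- (u * cosh (s - a))).
      by rewrite mulr_ge0 ?expR_ge0.
    by rewrite (ger0_norm e0) ler_piMr// cos_max.
have ih : itgT (fun a => 2 * besselK 0 u * (expR (- (x * cosh a)) * cos (0 * a))).
  exact: (integrableZl measurableT (2 * besselK 0 u) iK).
have [i1 i2 e] := Rintegral_swap (f := fun s a => expcosh2 x u s a * cos (tau * s))
  measurableT measurableT mf fy ih.
have iH s := itg_expcosh2 s x0 u0.
have sE : (fun s => convcosh x u s * cos (tau * s)) =
    (fun s => \int[mu]_a (expcosh2 x u s a * cos (tau * s))).
  by apply/funext => s; rewrite RintegralZr.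
rewrite sE; split; first exact: i1.
rewrite e.
rewrite (eq_Rintegral mu (g := fun a => 2 * besselK tau u * (expR (- (x * cosh a)) * cos (tau * a)))).
  have [j1 j2] := int_expcosh tau x0.
  by rewrite RintegralZl// j2; ring.
move=> a _.
have [j1 j2] := int_expcosh_shift tau a u0.
rewrite (eq_Rintegral mu (g := fun s => expR (- (x * cosh a)) * (expR (- (u * cosh (s - a))) * cos (tau * s)))).
  by rewrite RintegralZl// j2; ring.
by move=> s _; rewrite /expcosh2 mulrA.
Qed.

Definition kl_kernel x u y : R :=
  expR (- (1 / 2 * (x * ((u ^+ 2 + y ^+ 2) / (u * y)) + y * u / x))).

Lemma kl_kernel_ge0 x u y : 0 <= kl_kernel x u y. Proof. exact: expR_ge0. Qed.

Lemma measurable_kl_kernel d (T : measurableType d) x (f g : T -> R) :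
  measurable_fun setT f -> measurable_fun setT g ->
  measurable_fun setT (fun z => kl_kernel x (f z) (g z)).
Proof.
move=> mf mg; apply: measurableT_comp => //; apply: measurableT_comp => //.
apply: measurable_funM; first exact: measurable_cst.
apply: measurable_funD.
  apply: measurable_funM; first exact: measurable_cst.
  apply: measurable_funM; first by apply: measurable_funD; exact: measurable_funX.
  by apply: measurable_fun_inv; exact: measurable_funM.
apply: measurable_funM; last exact: measurable_cst.
exact: measurable_funM.
Qed.

(** The kernel of the product formula times e^{-y cosh s}, in the variable y = e^b. *)
Definition kl_kernel_exp x u s b : R :=
  expR (- (1 / 2 * (x * u * expR (- b) + (x / u + u / x + 2 * cosh s) * expR b))).

Lemma kl_kernel_expE x u s b : 0 < x -> 0 < u ->
  kl_kernel x u (expR b) * expR (- (expR b * cosh s)) = kl_kernel_exp x u s b.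
Proof.
move=> x0 u0; rewrite /kl_kernel /kl_kernel_exp -expRD expRN; congr expR.
have := expR_gt0 b; move: (expR b) (cosh s) => p c p0.
by field; rewrite !gt_eqF.
Qed.

(** Both exponents have the form A e^a + B e^{-a} with the same product A B, namely
    x^2 + u^2 + 2 x u cosh s; hence they differ by a translation. *)
Lemma expcosh2E x u s a : 0 < x -> 0 < u ->
  expcosh2 x u s a = kl_kernel_exp x u s (a + ln (x * u / (x + u * expR s))).
Proof.
move=> x0 u0; rewrite /expcosh2 /kl_kernel_exp -expRD; congr expR.
have q0 := expR_gt0 s.
have B0 : 0 < x + u * expR s by rewrite addr_gt0// mulr_gt0.
have C0 : 0 < x * u / (x + u * expR s) by rewrite divr_gt0// mulr_gt0.
have lE : expR (ln (x * u / (x + u * expR s))) = x * u / (x + u * expR s).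
  by rewrite lnK.
have -> : expR (- (a + ln (x * u / (x + u * expR s)))) =
    (expR a)^-1 / (x * u / (x + u * expR s)) by rewrite expRN expRD lE invfM.
have -> : expR (a + ln (x * u / (x + u * expR s))) =
    expR a * (x * u / (x + u * expR s)) by rewrite expRD lE.
rewrite /cosh opprB !expRB !expRN.
have := expR_gt0 a; move: q0 B0 {C0 lE}; move: (expR a) (expR s) => p q q0 B0 p0.
by field; rewrite !gt_eqF.
Qed.

Lemma continuous_kl_kernel_exp x u s : continuous (kl_kernel_exp x u s).
Proof.
have d b : is_derive b (1 : R) (kl_kernel_exp x u s)
    (- (1 / 2 * (- (x * u * expR (- b)) + (x / u + u / x + 2 * cosh s) * expR b)) * kl_kernel_exp x u s b).
  by apply: is_derive_eq; rewrite /kl_kernel_exp /GRing.scale/=; ring.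
exact: continuous_derive d.
Qed.

Lemma int_kl_kernel_exp x u s : 0 < x -> 0 < u ->
  itgT (kl_kernel_exp x u s) /\ \int[mu]_b kl_kernel_exp x u s b = convcosh x u s.
Proof.
move=> x0 u0; set c := ln (x * u / (x + u * expR s)).
have E : expcosh2 x u s = (fun a => kl_kernel_exp x u s (a + c)).
  by apply/funext => a; exact: expcosh2E.
have E' : kl_kernel_exp x u s = (fun a => expcosh2 x u s (a + - c)).
  by apply/funext => a; rewrite E /= subrK.
have ct : continuous (expcosh2 x u s).
  rewrite E => a; apply: (@continuous_comp _ _ _ (fun a => a + c) (kl_kernel_exp x u s)).
    by apply: cvgD; [exact: cvg_id|exact: cvg_cst].
  exact: continuous_kl_kernel_exp.
have i := itg_expcosh2 s x0 u0.
rewrite E'; split; first exact: integrable_shift.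
by rewrite Rintegral_shift.
Qed.

Lemma kl_kernel_exp_ge0 x u s y : 0 < y -> 0 <= kl_kernel x u y / y * expR (- (y * cosh s)).
Proof.
by move=> y0; rewrite mulr_ge0 ?expR_ge0// divr_ge0 ?kl_kernel_ge0// ltW.
Qed.

Lemma int_kl_kernel x u s : 0 < x -> 0 < u ->
  itg (fun y => kl_kernel x u y / y * expR (- (y * cosh s))) /\
  int0oo (fun y => kl_kernel x u y / y * expR (- (y * cosh s))) = convcosh x u s.
Proof.
move=> x0 u0.
have mF : measurable_fun setT (fun y => kl_kernel x u y / y * expR (- (y * cosh s))).
  apply: measurable_funM.
    apply: measurable_funM; last exact: measurable_fun_inv.
    by apply: measurable_kl_kernel; [exact: measurable_cst|].
  apply: measurableT_comp => //; apply: measurableT_comp => //.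
  by apply: measurable_funM => //; exact: measurable_cst.
have F0 y : 0 < y -> 0 <= kl_kernel x u y / y * expR (- (y * cosh s)).
  exact: kl_kernel_exp_ge0.
have cF y : 0 < y -> {for y, continuous (fun y => kl_kernel x u y / y * expR (- (y * cosh s)))}.
  move=> y0; have yn : y != 0 by rewrite gt_eqF.
  have un : u != 0 by rewrite gt_eqF.
  have cI : {for y, continuous (fun y : R => y^-1)} by exact: inv_continuous.
  apply: cvgM; first apply: cvgM => //.
    have cg : {for y, continuous (fun y : R => - (1 / 2 * (x * ((u ^+ 2 + y ^+ 2) / (u * y)) + y * u / x)))}.
      apply: cvgN; apply: cvgM; first exact: cvg_cst.
      apply: cvgD; last by apply: cvgM; [apply: cvgM; [exact: cvg_id|exact: cvg_cst]|exact: cvg_cst].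
      apply: cvgM; first exact: cvg_cst.
      apply: cvgM; first by apply: cvgD; [exact: cvg_cst|exact: exprn_continuous].
      apply: cvgV; first by rewrite mulf_neq0.
      by apply: cvgM; [exact: cvg_cst|exact: cvg_id].
    by apply: (continuous_comp cg); exact: continuous_expR.
  have cg : continuous (fun y : R => - (y * cosh s)).
    by move=> z; apply: cvgN; apply: cvgM; [exact: cvg_id|exact: cvg_cst].
  by apply: (@continuous_comp _ _ _ (fun y : R => - (y * cosh s)) expR); [exact: cg|exact: continuous_expR].
have E : (\int[mu]_(y in Rpos) (kl_kernel x u y / y * expR (- (y * cosh s)))%:E =
    \int[mu]_b (kl_kernel_exp x u s b)%:E)%E.
  rewrite ge0_integral_expR//; apply: eq_integral => b _; congr EFin.
  rewrite -(kl_kernel_expE s b x0 u0); field; rewrite gt_eqF// expR_gt0//.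
have [i e] := int_kl_kernel_exp s x0 u0.
split; last by rewrite /int0oo /Rintegral E -e.
apply/integrableP; split; first exact/measurable_EFinP/measurable_funTS.
under eq_integral.
  move=> y /set_mem; rewrite RposE => y0; rewrite /= ger0_norm ?F0//; over.
by rewrite E ltey_eq (integrable_fin_num _ i).
Qed.

(** For fixed s the integral in a of [expcosh2] is, by a translation and y = e^b, the integral
    of the kernel against e^{-y cosh s} dy/y; integrating against cos (tau s)
    rebuilds K_{i tau}(y). *)
Theorem macdonald_product tau x u : 0 < x -> 0 < u ->
  itg (fun y => kl_kernel x u y / y * besselK tau y) /\
  int0oo (fun y => kl_kernel x u y / y * besselK tau y) = 2 * (besselK tau x * besselK tau u).
Proof.
move=> x0 u0.
have mf : measurable_fun setT (fun z : R * R =>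
    kl_kernel x u z.1 / z.1 * expR (- (z.1 * cosh z.2)) * cos (tau * z.2)).
  apply: measurable_funM; last exact: measurable_coscomp.
  apply: measurable_funM.
    apply: measurable_funM; last exact: measurable_fun_inv.
    by apply: measurable_kl_kernel; [exact: measurable_cst|].
  apply: measurableT_comp => //; apply: measurableT_comp => //.
  by apply: measurable_funM => //; apply: measurableT_comp => //; exact: measurable_cosh.
have [iH _] := convcosh_swap 0 x0 u0.
have fy s : setT s -> itg (fun y => kl_kernel x u y / y * expR (- (y * cosh s)) * cos (tau * s)) /\
    \int[mu]_(y in Rpos) `|kl_kernel x u y / y * expR (- (y * cosh s)) * cos (tau * s)| <=
    convcosh x u s * cos (0 * s).
  move=> _; have [i e] := int_kl_kernel s x0 u0.
  have i1 : itg (fun y => kl_kernel x u y / y * expR (- (y * cosh s)) * cos (tau * s)).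
    by apply: itg_eq (itgZ (cos (tau * s)) i) => y _; rewrite mulrC.
  split; first exact: i1.
  rewrite mul0r cos0 mulr1 -e; apply: le_int0oo; [exact: itg_norm|exact: i|].
  move=> y y0; rewrite normrM.
  have F0 := kl_kernel_exp_ge0 x u s y0.
  by rewrite (ger0_norm F0) (ler_piMr F0 (cos_max _)).
have [i1 _ e] := Rintegral_swap
  (f := fun y s => kl_kernel x u y / y * expR (- (y * cosh s)) * cos (tau * s))
  measurable_Rpos measurableT mf fy iH.
have inner y : 0 < y ->
    \int[mu]_s (kl_kernel x u y / y * expR (- (y * cosh s)) * cos (tau * s)) =
    2 * (kl_kernel x u y / y * besselK tau y).
  move=> y0; have [j1 j2] := int_expcosh tau y0.
  rewrite (eq_Rintegral mu (g := fun s => kl_kernel x u y / y * (expR (- (y * cosh s)) * cos (tau * s)))).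
    by rewrite RintegralZl// j2; ring.
  by move=> s _; rewrite mulrA.
have i2 : itg (fun y => 2 * (kl_kernel x u y / y * besselK tau y)).
  by apply: itg_eq i1 => y y0; rewrite inner.
have i3 : itg (fun y => kl_kernel x u y / y * besselK tau y).
  by apply: itg_eq (itgZ 2^-1 i2) => y _; rewrite mulKf.
split; first exact: i3.
have two : (2 : R) != 0 by rewrite pnatr_eq0.
apply: (mulfI two); rewrite -int0ooZ//.
have -> : 2 * (2 * (besselK tau x * besselK tau u)) = 4 * (besselK tau x * besselK tau u) by ring.
rewrite -(convcosh_swap tau x0 u0).2.
transitivity (\int[mu]_(y in Rpos) (\int[mu]_s (kl_kernel x u y / y * expR (- (y * cosh s)) * cos (tau * s)))).
  by apply: int0oo_eq => y y0; rewrite inner.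
rewrite e; apply: eq_Rintegral => s _.
have [j1 j2] := int_kl_kernel s x0 u0.
by rewrite -j2 /int0oo RintegralZr//; exact: measurable_Rpos.
Qed.

End ProductFormula.

(** * The coefficients a_k and the convolutions *)

Section Final.
Context {R : realType}.
Notation mu := (@lebesgue_measure R).
Notation Rpos := (`]0%R, +oo[%classic : set R).
Notation itg f := (mu.-integrable Rpos (EFin \o f)).
Implicit Types x u s a b y tau : R.

Lemma pi_neq0 : pi != 0 :> R.
Proof. by rewrite gt_eqF// pi_gt0. Qed.

Lemma int0oo_dct (f_ : nat -> R -> R) (f g : R -> R) :
  (forall n, measurable_fun setT (f_ n)) -> measurable_fun setT f -> itg g ->
  (forall n x, 0 < x -> `|f_ n x| <= g x) ->
  (forall x, 0 < x -> f_ n x @[n --> \oo] --> f x) ->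
  int0oo (f_ n) @[n --> \oo] --> int0oo f.
Proof.
move=> mf_ mf ig fg cf.
have [] := @dominated_convergence _ _ R mu Rpos _ (fun n => EFin \o f_ n)
  (EFin \o f) (EFin \o g).
- exact: measurable_Rpos.
- by move=> n; apply/measurable_EFinP/measurable_funTS; exact: mf_.
- by apply/measurable_EFinP/measurable_funTS; exact: mf.
- apply/aeW => x; rewrite RposE => x0; apply/cvg_EFin; first exact/nearW.
  exact: cf.
- exact: ig.
- by apply/aeW => x n; rewrite RposE => x0; rewrite /= lee_fin fg.
move=> i _ c; rewrite /int0oo /Rintegral; apply: fine_cvg.
by rewrite fineK ?integrable_fin_num//; exact: c.
Qed.

Definition sinh_part (n : nat) (z : R) : R :=
  \sum_(j < n) z ^+ (2 * j + 1) / (2 * j + 1)`!%:R.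

(** The Taylor polynomial of sinh is half the difference of those of exp at z and -z,
    which reduces its convergence to the exponential series. *)
Lemma sinh_partE n z :
  2 * sinh_part n z = series (exp_coeff z) n.*2 - series (exp_coeff (- z)) n.*2.
Proof.
elim: n => [|n IH].
  by rewrite /sinh_part big_ord0 mulr0 /series /= !big_geq// subrr.
rewrite /sinh_part big_ord_recr /= mulrDr -/(sinh_part n z) IH.
rewrite doubleS /series /= !big_nat_recr//= /exp_coeff /=.
have e : (2 * n + 1 = n.*2.+1)%N by rewrite mul2n addn1.
rewrite e !exprS.
have -> : (- z) ^+ n.*2 = z ^+ n.*2 by rewrite -mul2n !exprM sqrrN.
by ring.
Qed.

Lemma sinh_part_ge0 n z : 0 <= z -> 0 <= sinh_part n z.
Proof.
by move=> z0; apply: sumr_ge0 => j _; rewrite divr_ge0// exprn_ge0.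
Qed.

Lemma cvg_sinh_part z : sinh_part n z @[n --> \oo] --> sinh z.
Proof.
have dbl : (fun n => n.*2) @ \oo --> \oo.
  apply/cvgnyPge => A; near=> n; rewrite (@leq_trans n)//.
    by near: n; exact: nbhs_infty_ge.
  by rewrite -addnn leq_addr.
have ce w : series (exp_coeff w) n.*2 @[n --> \oo] --> expR w.
  by apply: (cvg_comp (fun n => n.*2) (series (exp_coeff w)) dbl); exact: is_cvg_series_exp_coeff.
rewrite (_ : (fun n => sinh_part n z) =
  (fun n => (series (exp_coeff z) n.*2 - series (exp_coeff (- z)) n.*2) / 2)).
  by apply: cvgM; [apply: cvgB; exact: ce|exact: cvg_cst].
by apply/funext => n; rewrite -sinh_partE; field.
Unshelve. all: end_near. Qed.

Lemma sinh_part_le n z : 0 <= z -> sinh_part n z <= sinh z.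
Proof.
move=> z0; have c := @cvg_sinh_part z.
rewrite -(cvg_lim _ c)//; apply: (nondecreasing_cvgn_le (u_ := fun n => sinh_part n z)).
  apply/nondecreasing_seqP => m; rewrite /sinh_part big_ord_recr /= lerDl.
  by rewrite divr_ge0// exprn_ge0.
by apply/cvg_ex; exists (sinh z).
Qed.

Section Terms.
Variables t r : R.
Hypotheses (t0 : 0 < t) (r0 : 0 < r).

Lemma heat_kernelE x y : heat_kernel t x y =
  2 / (x * pi ^+ 2) * int0oo (fun tau => yor_density t tau * (besselK tau x * besselK tau y)).
Proof.
rewrite /heat_kernel; congr (_ * _); apply: int0oo_eq => tau _.
by rewrite !macdonald_imE /yor_density /gauss !mulrA.
Qed.

Lemma measurable_yor : measurable_fun setT (yor t).
Proof.
apply: measurable_funM; first exact: measurable_cst.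
apply: (@measurable_Rintegral R _ _ Rpos (fun y v : R => expR (- (v ^+ 2 / (2 * t))) *
   expR (- (y * cosh v)) * sinh v * sin (pi * v / t))); first exact: measurable_Rpos.
have m2 : measurable_fun setT (fun z : R * R => z.2) by exact: measurable_snd.
apply: measurable_funM; last first.
  apply: (measurableT_comp measurable_sin).
  by apply: measurable_funM => //; apply: measurable_funM => //; exact: measurable_cst.
apply: measurable_funM; last exact: (measurableT_comp measurable_sinh).
apply: measurable_funM.
  apply: measurableT_comp => //; apply: measurableT_comp => //.
  by apply: measurable_funM; [exact: measurable_funX|exact: measurable_cst].
apply: measurableT_comp => //; apply: measurableT_comp => //.
by apply: measurable_funM => //; exact: (measurableT_comp measurable_cosh).
Qed.

(** The product formula under the spectral integral of the heat kernel. *)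
Lemma heat_kernel_conv x u : 0 < x -> 0 < u ->
  int0oo (fun y => kl_kernel x u y * yor t y) = x * heat_kernel t x u.
Proof.
move=> x0 u0.
have mf : measurable_fun setT (fun z : R * R =>
    kl_kernel x u z.1 / z.1 * besselK z.2 z.1 * yor_density t z.2).
  apply: measurable_funM; last exact: (measurableT_comp (measurable_yor_density t)).
  apply: measurable_funM.
    apply: measurable_funM; last exact: measurable_fun_inv.
    by apply: measurable_kl_kernel; [exact: measurable_cst|].
  exact: (measurableT_comp (f := fun z : R * R => besselK z.1 z.2)
    (g := fun z : R * R => (z.2, z.1)) measurable_besselK
    (measurable_fun_pair measurable_snd measurable_fst)).
have [i0 e0] := macdonald_product 0 x0 u0.
have fy tau : 0 < tau -> itg (fun y => kl_kernel x u y / y * besselK tau y * yor_density t tau) /\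
   int0oo (fun y => `|kl_kernel x u y / y * besselK tau y * yor_density t tau|) <=
   2 * (besselK 0 x * besselK 0 u) * yor_density t tau.
  move=> tau0; have [i e] := macdonald_product tau x0 u0.
  have i1 : itg (fun y => kl_kernel x u y / y * besselK tau y * yor_density t tau).
    by apply: itg_eq (itgZ (yor_density t tau) i) => y _; rewrite mulrC.
  split; first exact: i1.
  have s0 := yor_density_ge0 t tau0.
  rewrite -e0 mulrC -int0ooZ; last exact: i0.
  apply: le_int0oo; [exact: itg_norm|exact: itgZ|move=> y y0].
  rewrite normrM mulrC (ger0_norm s0); apply: (ler_wpM2l s0).
  have k0 : 0 <= kl_kernel x u y / y by rewrite divr_ge0 ?kl_kernel_ge0// ltW.
  by rewrite normrM (ger0_norm k0); apply: (ler_wpM2l k0); exact: besselK_le.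
have [i1 i2 e] := int0oo_swap mf fy (itgZ _ (itg_yor_density t0)).
rewrite heat_kernelE.
rewrite (int0oo_eq (g := fun y => 1 / pi ^+ 2 *
    int0oo (fun tau => kl_kernel x u y / y * besselK tau y * yor_density t tau))); last first.
  move=> y y0; rewrite (yor_spectral t0 y0).
  rewrite (int0oo_eq (f := fun tau => kl_kernel x u y / y * besselK tau y * yor_density t tau)
     (g := fun tau => kl_kernel x u y / y * (yor_density t tau * besselK tau y))); last first.
    by move=> tau _; ring.
  rewrite int0ooZ.
    have alg (p A B : R) : p != 0 -> A * (1 / (y * p ^+ 2) * B) = 1 / p ^+ 2 * (A / y * B).
      by move=> p0; field; rewrite p0 gt_eqF.
    by apply: alg; exact: pi_neq0.
  apply: itg_le (itgZ (besselK 0 y) (itg_yor_density t0)).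
    by apply: measurable_funM; [exact: measurable_yor_density|exact: measurable_besselK1].
  move=> tau tau0; have s0 := yor_density_ge0 t tau0.
  by rewrite normrM mulrC (ger0_norm s0); apply: (ler_wpM2r s0); exact: besselK_le.
rewrite int0ooZ; last exact: i1.
rewrite e.
rewrite (int0oo_eq (g := fun tau => 2 * (yor_density t tau * (besselK tau x * besselK tau u)))).
  rewrite int0ooZ; last first.
    apply: itg_eq (itgZ 2^-1 i2) => tau tau0; have [i e'] := macdonald_product tau x0 u0.
    rewrite (int0oo_eq (g := fun y => yor_density t tau * (kl_kernel x u y / y * besselK tau y))).
      have two : (2 : R) != 0 by rewrite pnatr_eq0.
      by rewrite (int0ooZ _ i) e' [LHS]mulrCA (mulKf two).
    by move=> y _; rewrite mulrC.
  have alg (p B : R) : p != 0 -> 1 / p ^+ 2 * (2 * B) = x * (2 / (x * p ^+ 2) * B).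
    by move=> p0; field; rewrite p0 gt_eqF.
  by apply: alg; exact: pi_neq0.
move=> tau tau0; have [i e'] := macdonald_product tau x0 u0.
rewrite (int0oo_eq (g := fun y => yor_density t tau * (kl_kernel x u y / y * besselK tau y))).
  by rewrite (int0ooZ _ i) e' mulrCA.
by move=> y _; rewrite mulrC.
Qed.

Definition gaussK_moment n : R := int0oo (fun tau => gauss t tau * tau ^+ n.+1.*2 * besselK tau r).

Lemma measurable_expoly n : measurable_fun setT (fun u : R => expR (- u) * (klpoly n).[u]).
Proof.
apply: measurable_funM; first by apply: measurableT_comp => //; exact: measurableT_comp.
by apply: continuous_measurable; exact: continuous_horner.
Qed.

Lemma itg_gaussK_moment n : itg (fun tau => gauss t tau * tau ^+ n.+1.*2 * besselK tau r).
Proof.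
apply: itg_le (itgZ (besselK 0 r) (itg_gauss t0 n.+1.*2 0)).
  apply: measurable_funM; last exact: measurable_besselK1.
  by apply: measurable_funM; [exact: measurable_gauss|exact: measurable_funX].
move=> tau tau0.
have -> : besselK 0 r * (tau ^+ n.+1.*2 * (gauss t tau * expR (0 * tau))) =
   gauss t tau * tau ^+ n.+1.*2 * besselK 0 r by rewrite mul0r expR0; ring.
have g0 : 0 <= gauss t tau * tau ^+ n.+1.*2.
  by rewrite mulr_ge0 ?gauss_ge0// exprn_ge0// ltW.
by rewrite normrM (ger0_norm g0); apply: (ler_wpM2l g0); exact: besselK_le.
Qed.

(** After the exchange of integrals, the moment of p_{n+1} brings the factor
    pi tau^{2n+1}/sinh (pi tau), whose denominator cancels the sinh of the
    spectral density. *)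
Lemma yor_aE n : yor_a n.+1 r t = (-1) ^+ n.+1 * (2 / (r * pi) * gaussK_moment n).
Proof.
have mf : measurable_fun setT (fun z : R * R =>
    expR (- z.1) * (klpoly n).[z.1] * (yor_density t z.2 * (besselK z.2 r * besselK z.2 z.1))).
  apply: measurable_funM; first exact: (measurableT_comp (measurable_expoly n)).
  apply: measurable_funM; first exact: (measurableT_comp (measurable_yor_density t)).
  apply: measurable_funM; first exact: (measurableT_comp (measurable_besselK1 r)).
  exact: (measurableT_comp (f := fun z : R * R => besselK z.1 z.2)
    (g := fun z : R * R => (z.2, z.1)) measurable_besselK
    (measurable_fun_pair measurable_snd measurable_fst)).
have iM := itg_norm (itg_klmoment (0 : R) (klpoly n)).
set M := int0oo (fun u => `|expR (- u) * (klpoly n).[u] * besselK 0 u|).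
have fy tau : 0 < tau -> itg (fun u => expR (- u) * (klpoly n).[u] * (yor_density t tau * (besselK tau r * besselK tau u))) /\
   int0oo (fun u => `|expR (- u) * (klpoly n).[u] * (yor_density t tau * (besselK tau r * besselK tau u))|) <=
   besselK 0 r * M * yor_density t tau.
  move=> tau0; have i := itg_klmoment tau (klpoly n).
  have i1 : itg (fun u => expR (- u) * (klpoly n).[u] * (yor_density t tau * (besselK tau r * besselK tau u))).
    by apply: itg_eq (itgZ (yor_density t tau * besselK tau r) i) => u _; ring.
  split; first exact: i1.
  have s0 := yor_density_ge0 t tau0.
  have -> : besselK 0 r * M * yor_density t tau = yor_density t tau * besselK 0 r * M by ring.
  rewrite /M -int0ooZ; last exact: iM.
  apply: le_int0oo; [exact: itg_norm|exact: itgZ|move=> u u0].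
  have -> : expR (- u) * (klpoly n).[u] * (yor_density t tau * (besselK tau r * besselK tau u)) =
    yor_density t tau * (besselK tau r * (expR (- u) * (klpoly n).[u] * besselK tau u)) by ring.
  rewrite normrM (ger0_norm s0) -[leRHS]mulrA; apply: (ler_wpM2l s0).
  rewrite normrM; apply: ler_pM; [exact: normr_ge0|exact: normr_ge0|exact: besselK_le|].
  rewrite !normrM; apply: ler_wpM2l; first by rewrite mulr_ge0.
  by rewrite (ger0_norm (besselK0_ge0 u)); exact: besselK_le.
have [i1 i2 e] := int0oo_swap mf fy (itgZ _ (itg_yor_density t0)).
rewrite /yor_a.
rewrite (int0oo_eq (g := fun u => (-1) ^+ n.+1 * (2 / (r * pi ^+ 2)) *
   int0oo (fun tau => expR (- u) * (klpoly n).[u] * (yor_density t tau * (besselK tau r * besselK tau u))))); last first.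
  move=> u u0; rewrite heat_kernelE yor_polyE.
  rewrite int0ooZ.
    have un : u != 0 by rewrite gt_eqF.
    have alg (A B C D S : R) : A * (C * B) * (S * (u * D)) / u = S * C * (A * D * B).
      by field.
    exact: alg.
  apply: itg_le (itgZ (besselK 0 r * besselK 0 u) (itg_yor_density t0)).
    apply: measurable_funM; first exact: measurable_yor_density.
    by apply: measurable_funM; exact: measurable_besselK1.
  move=> tau tau0; have s0 := yor_density_ge0 t tau0.
  rewrite normrM mulrC (ger0_norm s0); apply: (ler_wpM2r s0).
  by rewrite normrM; apply: ler_pM; [exact: normr_ge0|exact: normr_ge0|exact: besselK_le|exact: besselK_le].
rewrite int0ooZ; last exact: i1.
rewrite e -[LHS]mulrA; congr (_ * _).
rewrite (int0oo_eq (g := fun tau => pi * (gauss t tau * tau ^+ n.+1.*2 * besselK tau r))).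
  rewrite int0ooZ.
    rewrite -/(gaussK_moment n).
    have rn : r != 0 by rewrite gt_eqF.
    have alg (p B : R) : p != 0 -> 2 / (r * p ^+ 2) * (p * B) = 2 / (r * p) * B.
      by move=> p0; field; rewrite p0 rn.
    by apply: alg; exact: pi_neq0.
  exact: itg_gaussK_moment.
move=> tau tau0.
rewrite (int0oo_eq (g := fun u => yor_density t tau * besselK tau r * (expR (- u) * (klpoly n).[u] * besselK tau u))); last first.
  by move=> u _; ring.
rewrite int0ooZ; last exact: itg_klmoment.
rewrite -/(klmoment tau (klpoly n)) klmoment_klpoly /yor_density.
have h := sechsq_moment_sinh tau0.
transitivity (gauss t tau * tau * tau ^+ n.*2 * besselK tau r * (sechsq_moment tau 1 * sinh (pi * tau))); first by ring.
by rewrite h doubleS !exprS; ring.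
Qed.

(** The product formula at tau = 0 integrates the right-hand side in y, which
    justifies the exchange of integrals in [KLconvE]. *)
Lemma kl_kernel_yor_le u y (q : R) : 0 < y ->
  `|kl_kernel r u y * q * yor t y| <=
  `|q| * (int0oo (yor_density t) / pi ^+ 2) * (kl_kernel r u y / y * besselK 0 y).
Proof.
move=> y0; rewrite normrM (normrM (kl_kernel r u y)) (ger0_norm (kl_kernel_ge0 _ _ _)).
have := yor_le t0 y0; move: (int0oo (yor_density t) / pi ^+ 2) => C h.
have -> : `|q| * C * (kl_kernel r u y / y * besselK 0 y) =
  kl_kernel r u y * `|q| * (C * (besselK 0 y / y)) by ring.
by apply: ler_wpM2l; [rewrite mulr_ge0 ?kl_kernel_ge0|exact: h].
Qed.

(** [yor_g] as an entire function of u: the division by u is carried out. *)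
Definition yor_gpoly n u : R := (-1) ^+ n.+1 * (expR (- u) * (klpoly n).[u]).

Lemma measurable_yor_gpoly n : measurable_fun setT (yor_gpoly n).
Proof. by apply: measurable_funM; [exact: measurable_cst|exact: measurable_expoly]. Qed.

Lemma norm_yor_gpoly n u : `|yor_gpoly n u| = `|expR (- u) * (klpoly n).[u]|.
Proof. by rewrite /yor_gpoly normrM normrX normrN1 expr1n mul1r. Qed.

Lemma KLconvE n : KLconv (yor_g n.+1) (yor t) r = yor_a n.+1 r t / 2.
Proof.
have mf : measurable_fun setT (fun z : R * R =>
    kl_kernel r z.2 z.1 * yor_gpoly n z.2 * yor t z.1).
  apply: measurable_funM; last exact: (measurableT_comp measurable_yor).
  apply: measurable_funM; last exact: (measurableT_comp (measurable_yor_gpoly n)).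
  by apply: measurable_kl_kernel.
have iM := itg_norm (itg_klmoment (0 : R) (klpoly n)).
have fy u : 0 < u -> itg (fun y => kl_kernel r u y * yor_gpoly n u * yor t y) /\
   int0oo (fun y => `|kl_kernel r u y * yor_gpoly n u * yor t y|) <=
   (int0oo (yor_density t) / pi ^+ 2) * 2 * besselK 0 r * `|expR (- u) * (klpoly n).[u] * besselK 0 u|.
  move=> u0; have [i0 e0] := macdonald_product 0 r0 u0.
  have mq : measurable_fun setT (fun y => kl_kernel r u y * yor_gpoly n u * yor t y).
    apply: measurable_funM; last exact: measurable_yor.
    apply: measurable_funM; last exact: measurable_cst.
    by apply: measurable_kl_kernel; [exact: measurable_cst|].
  have bnd y : 0 < y -> _ := @kl_kernel_yor_le u y (yor_gpoly n u).
  have i1 := itg_le mq bnd (itgZ _ i0).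
  split; first exact: i1.
  have -> : (int0oo (yor_density t) / pi ^+ 2) * 2 * besselK 0 r * `|expR (- u) * (klpoly n).[u] * besselK 0 u| =
     `|yor_gpoly n u| * (int0oo (yor_density t) / pi ^+ 2) * (2 * (besselK 0 r * besselK 0 u)).
    by rewrite normrM -norm_yor_gpoly (ger0_norm (besselK0_ge0 u)); ring.
  rewrite -e0 -int0ooZ; last exact: i0.
  by apply: le_int0oo; [exact: itg_norm|exact: itgZ|exact: bnd].
have [i1 i2 e] := int0oo_swap mf fy (itgZ _ iM).
have inner u : 0 < u -> int0oo (fun y => kl_kernel r u y * yor_gpoly n u * yor t y) =
    r * (expR (- u) * heat_kernel t r u * yor_poly n.+1 u / u).
  move=> u0; have un : u != 0 by rewrite gt_eqF.
  rewrite (int0oo_eq (g := fun y => yor_gpoly n u * (kl_kernel r u y * yor t y))); last first.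
    by move=> y _; ring.
  rewrite int0ooZ.
    rewrite (heat_kernel_conv r0 u0) yor_polyE /yor_gpoly.
    have alg (A B C D : R) : A * (B * C) * (r * D) = r * (B * D * (A * (u * C)) / u) by field.
    exact: alg.
  have mq : measurable_fun setT (fun y => kl_kernel r u y * 1 * yor t y).
    apply: measurable_funM; last exact: measurable_yor.
    apply: measurable_funM; last exact: measurable_cst.
    by apply: measurable_kl_kernel; [exact: measurable_cst|].
  have [i0 e0] := macdonald_product 0 r0 u0.
  have bnd y : 0 < y -> _ := @kl_kernel_yor_le u y 1.
  by apply: itg_eq (itg_le mq bnd (itgZ _ i0)) => y _; rewrite mulr1.
rewrite /KLconv.
rewrite (int0oo_eq (g := fun y => int0oo (fun u => kl_kernel r u y * yor_gpoly n u * yor t y))); last first.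
  move=> y y0; apply: int0oo_eq => u u0.
  by rewrite yor_gE; last exact: lt0r_neq0.
rewrite e (int0oo_eq inner) int0ooZ.
  rewrite -/(yor_a n.+1 r t); have rn : r != 0 by rewrite gt_eqF.
  by move: (yor_a n.+1 r t) => A; field.
apply: itg_eq (itgZ r^-1 i2) => u u0.
by rewrite (inner u u0) (mulKf (lt0r_neq0 r0)).
Qed.

Lemma measurable_sinh_part n : measurable_fun setT (fun tau : R => sinh_part n (pi * tau)).
Proof.
apply: measurable_sum => j; apply: measurable_funM; last exact: measurable_cst.
by apply: measurable_funX.
Qed.

Definition partial_yor n : R :=
  1 / (r * pi ^+ 2) * int0oo (fun tau => gauss t tau * tau * sinh_part n (pi * tau) * besselK tau r).

Lemma partial_yorE n : partial_yor n =
  \sum_(j < n) pi ^+ (2 * j) / (2 * j + 1)`!%:R / (r * pi) * gaussK_moment j.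
Proof.
have i m : itg (fun tau => gauss t tau * tau * sinh_part m (pi * tau) * besselK tau r) /\
  int0oo (fun tau => gauss t tau * tau * sinh_part m (pi * tau) * besselK tau r) =
  \sum_(j < m) (pi ^+ (2 * j + 1) / (2 * j + 1)`!%:R * gaussK_moment j).
  elim: m => [|m [i e]].
    have z tau : gauss t tau * tau * sinh_part 0 (pi * tau) * besselK tau r = 0.
      by rewrite /sinh_part big_ord0 mulr0 mul0r.
    rewrite big_ord0; split.
      by apply: itg_eq (itgZ 0 (itg_gaussK_moment 0)) => tau _; rewrite z mul0r.
    rewrite (int0oo_eq (g := fun tau => 0 * (gauss t tau * tau ^+ 2 * besselK tau r))).
      by rewrite int0ooZ ?mul0r//; exact: (itg_gaussK_moment 0).
    by move=> tau _; rewrite z mul0r.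
  pose c : R := pi ^+ (2 * m + 1) / (2 * m + 1)`!%:R.
  have E tau : gauss t tau * tau * sinh_part m (pi * tau) * besselK tau r +
      c * (gauss t tau * tau ^+ m.+1.*2 * besselK tau r) =
      gauss t tau * tau * sinh_part m.+1 (pi * tau) * besselK tau r.
    rewrite /sinh_part big_ord_recr /= /c exprMn.
    have -> : tau ^+ m.+1.*2 = tau * tau ^+ (2 * m + 1).
      by rewrite -exprS -mul2n; congr (_ ^+ _); lia.
    by ring.
  split; first by apply: itg_eq (itgD i (itgZ c (itg_gaussK_moment m))) => tau _; exact: E.
  rewrite big_ord_recr /= -e -/c -int0ooZ; last exact: itg_gaussK_moment.
  by rewrite -int0ooD; [apply: int0oo_eq => tau _; rewrite E|exact: i|exact/itgZ/itg_gaussK_moment].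
rewrite /partial_yor (i n).2 mulr_sumr; apply: eq_bigr => j _.
have rn : r != 0 by rewrite gt_eqF.
have alg (p P K F : R) : p != 0 -> F != 0 -> 1 / (r * p ^+ 2) * (P * p / F * K) = P / F / (r * p) * K.
  by move=> p0 F0; field; rewrite p0 rn F0.
have -> : pi ^+ (2 * j + 1) = pi ^+ (2 * j) * pi :> R by rewrite addn1 exprSr.
by apply: alg; [exact: pi_neq0|rewrite pnatr_eq0 -lt0n fact_gt0].
Qed.

Lemma cvg_partial_yor : partial_yor n @[n --> \oo] --> yor t r.
Proof.
rewrite yor_spectral//; apply: cvgM; first exact: cvg_cst.
apply: (int0oo_dct (g := fun tau => besselK 0 r * yor_density t tau)).
- move=> n; apply: measurable_funM; last exact: measurable_besselK1.
  apply: measurable_funM; last exact: measurable_sinh_part.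
  by apply: measurable_funM; first exact: measurable_gauss.
- by apply: measurable_funM; [exact: measurable_yor_density|exact: measurable_besselK1].
- exact/itgZ/itg_yor_density.
- move=> n tau tau0.
  have z0 : 0 <= pi * tau by rewrite mulr_ge0 ?pi_ge0// ltW.
  have s0 := sinh_part_ge0 n z0; have s1 := sinh_part_le n z0.
  have g0 : 0 <= gauss t tau * tau by rewrite mulr_ge0 ?gauss_ge0// ltW.
  rewrite normrM (ger0_norm (mulr_ge0 g0 s0)) mulrC.
  apply: ler_pM; [exact: normr_ge0|exact: mulr_ge0|exact: besselK_le|].
  exact: ler_wpM2l.
- move=> tau tau0; apply: cvgM; last exact: cvg_cst.
  by apply: cvgM; [exact: cvg_cst|exact: cvg_sinh_part].
Qed.

End Terms.

End Final.

(** * The two series *)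

Theorem theorem4 (R : realType) (r t : R) (hr : 0 < r) (ht : 0 < t) :
  (\sum_(1 <= k < n.+1)
      ((-1) ^+ k * pi ^+ (2 * (k - 1)) / ((2 * k - 1)`!)%:R *
       KLconv (yor_g k) (yor t) r)) @[n --> \oo] --> yor t r
  /\
  (1 / 2 * \sum_(1 <= k < n.+1)
      ((-1) ^+ k * pi ^+ (2 * (k - 1)) * yor_a k r t / ((2 * k - 1)`!)%:R))
    @[n --> \oo] --> yor t r.
Proof.
have c := cvg_partial_yor ht hr.
have rn : r != 0 by rewrite gt_eqF.
have sg (j : nat) : (-1) ^+ j.+1 * (-1) ^+ j.+1 = 1 :> R.
  by rewrite -expr2 sqrr_sign.
have k1 (j : nat) : (2 * (j.+1 - 1) = 2 * j)%N by rewrite subn1.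
have k2 (j : nat) : (2 * j.+1 - 1 = 2 * j + 1)%N by lia.
split.
- rewrite (_ : (fun n => _) = partial_yor t r); first exact: c.
  apply/funext => n; rewrite big_add1 /= big_mkord partial_yorE//.
  apply: eq_bigr => j _; rewrite KLconvE// yor_aE// k1 k2.
  have alg (S P F p K : R) : S * S = 1 -> p != 0 ->  F != 0 ->
     S * P / F * (S * (2 / (r * p) * K) / 2) = P / F / (r * p) * K.
    move=> S1 p0 F0; transitivity (S * S * (P / F / (r * p) * K)); first by field; rewrite p0 rn F0.
    by rewrite S1 mul1r.
  by apply: alg; [exact: sg|exact: pi_neq0|rewrite pnatr_eq0 -lt0n fact_gt0].
- rewrite (_ : (fun n => _) = partial_yor t r); first exact: c.
  apply/funext => n; rewrite big_add1 /= big_mkord partial_yorE// mulr_sumr.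
  apply: eq_bigr => j _; rewrite yor_aE// k1 k2.
  have alg (S P F p K : R) : S * S = 1 -> p != 0 ->  F != 0 ->
     1 / 2 * (S * P * (S * (2 / (r * p) * K)) / F) = P / F / (r * p) * K.
    move=> S1 p0 F0; transitivity (S * S * (P / F / (r * p) * K)); first by field; rewrite p0 rn F0.
    by rewrite S1 mul1r.
  by apply: alg; [exact: sg|exact: pi_neq0|rewrite pnatr_eq0 -lt0n fact_gt0].
Qed.
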